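(* Let $N\ge 2$ be an integer and, for $\beta\ge 0$ and $b\ge 0$, let $$\Phi_\beta(b)=b\frac{I_{N/2}(b)}{I_{N/2-1}(b)}+\log\left[\frac{A_N}{A_{N-1}}\frac{b^{N/2-1}}{B_N\pi I_{N/2-1}(b)}\right]-\frac{\beta}{2}\left(\frac{I_{N/2}(b)}{I_{N/2-1}(b)}\right)^2.$$ (a) If $\beta\le N$, then $\Phi_\beta$ is minimized over $[0,\infty)$ at $b=0$, the corresponding minimizing density is constant, and the set of canonical macrostates is $\mathcal{E}_\beta=\{\mu\}$. (b) If $\beta>N$, the minimizer $b$ of $\Phi_\beta$ over $[0,\infty)$ is the unique strictly positive solution of $b=\beta\frac{I_{N/2}(b)}{I_{N/2-1}(b)}$, and $\lim_{\beta\downarrow N}b=0$. The set of canonical macrostates is $\mathcal{E}_\beta=\{\nu_x\}_{x\in\mathbb{S}^{N-1}}$, where $\nu_x$ is the probability measure on $\mathbb{S}^{N-1}$ whose density with respect to $\mu$ is $y\mapsto g(\langle x,y\rangle)$ with $g(t)$ proportional to $e^{bt}$ (with this $b$).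
   Context: $\mu$ is the uniform probability measure on $\mathbb{S}^{N-1}\subset\mathbb{R}^N$, $M_1(\mathbb{S}^{N-1})$ the probability measures on $\mathbb{S}^{N-1}$, $H(\nu\mid\mu)$ the relative entropy. The canonical macrostates $\mathcal{E}_\beta$ are the minimizers over $\nu\in M_1(\mathbb{S}^{N-1})$ of $H(\nu\mid\mu)-\frac{\beta}{2}\left|\int x\,d\nu(x)\right|^2$ (equivalently the zeros of the rate function of the empirical spin distribution under the mean-field $O(N)$ Gibbs measure at inverse temperature $\beta$). $I_\nu$ is the modified Bessel function of the first kind; $A_N=2\pi^{N/2}/\Gamma(N/2)$; $B_N=\prod_{k=0}^{N/2-1}|2k-1|$ for $N$ even and $B_N=2^{(N-3)/2}(1)_{(N-3)/2}$ for $N$ odd, $(a)_m$ the Pochhammer symbol. *)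

(* Defs.v *)
From HB Require Import structures.
From mathcomp Require Import all_boot all_order all_algebra.
From mathcomp Require Import all_classical all_reals all_analysis.
Set Implicit Arguments. Unset Strict Implicit. Unset Printing Implicit Defensive.
Import Order.TTheory GRing.Theory Num.Theory.
Import numFieldNormedType.Exports.
Local Open Scope classical_set_scope.
Local Open Scope ring_scope.

Section Defs.
Variables (R : realType) (N : nat).

(* points of R^N; measurable structure = product (coordinate) sigma-algebra,
   which for R^N is the Borel sigma-algebra *)
Definition vec := N.-tuple R.

Definition dotp (x y : vec) : R := \sum_(i < N) tnth x i * tnth y i.

Definition sphere : set vec := [set x | dotp x x = 1].

Definition rotate (O : 'M[R]_N) (x : vec) : vec :=
  [tuple \sum_(j < N) tnth x j * O j i | i < N].

(* mu is the uniform probability measure on S^{N-1}: concentrated on the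
   sphere and invariant under all orthogonal transformations (this
   characterizes it uniquely, N >= 2) *)
Definition is_uniform_sphere (mu : probability vec R) : Prop :=
  mu sphere = 1%E /\
  forall O : 'M[R]_N, O *m O^T = 1%:M ->
    forall A : set vec, measurable A -> mu (rotate O @^-1` A) = mu A.

(* probability measures on S^{N-1}, seen as probability measures on R^N
   concentrated on the sphere *)
Definition on_sphere (nu : probability vec R) : Prop := nu sphere = 1%E.

Definition density_of (mu nu : probability vec R) (f : vec -> R) : Prop :=
  measurable_fun setT f /\ (forall x, 0 <= f x) /\
  forall A : set vec, measurable A -> nu A = (\int[mu]_(x in A) (f x)%:E)%E.

(* relative entropy H(nu | mu) = int f log f dmu if nu << mu with density f,
   +oo otherwise (ln 0 = 0 in mathcomp, so 0 log 0 = 0) *)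
Definition relent (mu nu : probability vec R) : \bar R :=
  match pselect (exists f, density_of mu nu f) with
  | left h => let f := projT1 (cid h) in (\int[mu]_x (f x * ln (f x))%:E)%E
  | right _ => (+oo)%E
  end.

Definition mean (nu : probability vec R) (i : 'I_N) : R :=
  fine (\int[nu]_(x in sphere) (tnth x i)%:E)%E.

Definition freeE (mu : probability vec R) (beta : R) (nu : probability vec R)
  : \bar R :=
  (relent mu nu - (beta / 2 * \sum_(i < N) mean nu i ^+ 2)%:E)%E.

Definition macrostate (mu : probability vec R) (beta : R)
  (nu : probability vec R) : Prop :=
  on_sphere nu /\
  forall nu' : probability vec R, on_sphere nu' ->
    (freeE mu beta nu <= freeE mu beta nu')%E.

End Defs.

Section Special.
Variable R : realType.

Definition Gamma (s : R) : R :=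
  fine (\int[@lebesgue_measure R]_(t in `]0%R, +oo[)
          (powR t (s - 1) * expR (- t))%:E)%E.

Definition besselI (nu b : R) : R :=
  limn (series (fun k : nat =>
    powR (b / 2) ((2 * k)%:R + nu) / (k`!%:R * Gamma (k%:R + nu + 1)))).

Definition A_ (n : nat) : R := 2 * powR pi (n%:R / 2) / Gamma (n%:R / 2).

Definition pochhammer (a : R) (m : nat) : R := \prod_(i < m) (a + i%:R).

Definition B_ (n : nat) : R :=
  if odd n then 2 ^+ ((n - 3) %/ 2) * pochhammer 1 ((n - 3) %/ 2)
  else \prod_(k < n %/ 2) `|2 * k%:R - 1|.

Definition ratioI (n : nat) (b : R) : R :=
  besselI (n%:R / 2) b / besselI (n%:R / 2 - 1) b.

(* Phi_beta(b), literal formula (meaningful for b > 0) *)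
Definition Phi (n : nat) (beta b : R) : R :=
  b * ratioI n b
  + ln (A_ n / A_ n.-1 * powR b (n%:R / 2 - 1)
        / (B_ n * pi * besselI (n%:R / 2 - 1) b))
  - beta / 2 * ratioI n b ^+ 2.

Definition PhiExt (n : nat) (beta b : R) : R :=
  if b == 0 then lim (Phi n beta x @[x --> 0^'+]) else Phi n beta b.

End Special.

(* Main.v *)
(* Let f be the moment generating function of a coordinate under mu.  Rotation invariance
   gives E (y_i + c y_j)^(2k) = (1 + c^2)^k E y_i^(2k), hence the moments of a coordinate
   and the power series of f and f', which up to a common factor are those of I_(N/2-1) and
   I_(N/2).  So the Bessel ratio is m = f'/f = (ln f)', the mean of the tilted law nu_x, and
   Phi(b) = b m(b) - ln f(b) - beta/2 m(b)^2 up to a constant.  The coefficients of the two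
   series have a decreasing quotient, so m(b)/b decreases strictly from 1/N; hence
   b = beta m(b) has a positive solution, then unique, exactly when beta > N.
   Gibbs' inequality H(nu|mu) >= b <x, mean nu> - ln f(b), an equality only for the tilted
   law, taken at b = beta r with r = |mean nu| and x = mean nu / r, bounds the free energy
   below by K(r) = beta/2 r^2 - ln f(beta r).  By the monotonicity of m(b)/b, K is minimal
   exactly where beta r is that b (or 0 if beta <= N), and there the tilted laws attain the bound.
   Similarly Phi(b) >= K(m(b)) by convexity of ln f. *)
Require Import Defs.
From HB Require Import structures.
From mathcomp Require Import all_boot all_order all_algebra.
From mathcomp Require Import all_classical all_reals all_analysis.
From mathcomp Require Import measurable_realfun.
From mathcomp Require Import ring lra zify.
Set Implicit Arguments. Unset Strict Implicit. Unset Printing Implicit Defensive.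
Import Order.TTheory GRing.Theory Num.Theory.
Import numFieldNormedType.Exports.
Local Open Scope classical_set_scope.
Local Open Scope ring_scope.

(** * The Gamma function *)

Section GammaFunction.
Context {R : realType}.
Local Notation leb := (@lebesgue_measure R).

(** The law of a coordinate under [mu] is never computed. Its moments obey a two-term recursion,
    which is that of the Bessel coefficients once [Gamma (s + 1) = s * Gamma s] is known; this
    equation and positivity are all that is asked of [Gamma]. Likewise [A_], [B_] and [pi] enter
    [Phi] only through a positive factor inside the logarithm, hence through an additive constant.
    The free energy is a difference of two convex functionals, so convexity alone neither finds nor
    counts its minimizers. Its first variation at [nu] is, up to a constant, the logarithm of the
    density minus [beta] times the inner product with the mean of [nu]; a critical density is
    therefore a tilted one with parameter [beta * r], and this dictates the parameter used in Gibbs'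
    inequality. Uniqueness needs a strict form of each inequality: for the ratio of the series, for
    the tangent to the logarithm of the moment generating function and for Gibbs' inequality. *)

Definition gammaf (s t : R) : R := powR t (s - 1) * expR (- t).

(** Compact intervals that exhaust the half-line and avoid 0, where the integrand is singular for
    [s < 1]. The shift by 2 makes the endpoints distinct already for [n = 0]. *)
Definition gamma_itv (n : nat) : set R := `[n.+2%:R^-1, n.+2%:R].

Lemma gammaf_ge0 s t : 0 <= gammaf s t.
Proof. by rewrite mulr_ge0 ?powR_ge0 ?expR_ge0. Qed.

Lemma measurable_gammaf s : measurable_fun setT (gammaf s).
Proof.
apply: measurable_funM; first exact: measurable_powR.
by apply: measurableT_comp => //; exact: measurable_funN.
Qed.

Lemma is_derive_powR_expRN (s t : R) : 0 < t ->
  is_derive t 1 (fun t => powR t s * expR (- t)) (s * gammaf s t - gammaf (s + 1) t).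
Proof.
move=> t0.
have dp := is_derive1_powR s t0.
apply: is_derive_eq.
rewrite /gammaf addrK /GRing.scale /=; ring.
Qed.

Lemma gamma_itv_gt0 n t : gamma_itv n t -> 0 < t.
Proof. by rewrite /gamma_itv /= in_itv/= => /andP[h _]; exact: lt_le_trans h. Qed.

Lemma gamma_itv_lt n : (n.+2%:R^-1 < n.+2%:R :> R).
Proof. by rewrite (@lt_trans _ _ 1) ?invf_lt1 ?ltr1n. Qed.

Lemma continuous_gammaf s (t : R) : 0 < t -> {for t, continuous (gammaf s)}.
Proof.
move=> t0; have := is_derive_powR_expRN (s - 1) t0 => -[+ _].
by move=> /derivable1_diffP /differentiable_continuous.
Qed.

Lemma within_gamma_itv (f : R -> R) n : (forall t, 0 < t -> {for t, continuous f}) ->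
  {within gamma_itv n, continuous f}.
Proof.
move=> cf; apply: continuous_in_subspaceT => t; rewrite inE => /gamma_itv_gt0.
exact: cf.
Qed.

Lemma integrable_gamma_itv s n : leb.-integrable (gamma_itv n) (EFin \o gammaf s).
Proof.
apply: continuous_compact_integrable; first exact: segment_compact.
by apply: within_gamma_itv => t; exact: continuous_gammaf.
Qed.

(** Integration by parts, in the form of the fundamental theorem of calculus for
    [t ^ s * exp (- t)]. *)
Lemma integral_gamma_itv s n :
  (s%:E * \int[leb]_(t in gamma_itv n) (gammaf s t)%:E =
   \int[leb]_(t in gamma_itv n) (gammaf (s + 1) t)%:E +
   (powR n.+2%:R s * expR (- n.+2%:R)
     - powR n.+2%:R^-1 s * expR (- n.+2%:R^-1))%:E)%E.
Proof.
have mI : measurable (gamma_itv n : set R) by exact: measurable_itv.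
pose F t := powR t s * expR (- t).
pose f t := s * gammaf s t - gammaf (s + 1) t.
have dF (t : R) : 0 < t -> is_derive t 1 F (f t) by move=> t0; exact: is_derive_powR_expRN.
have cF (t : R) : 0 < t -> {for t, continuous F}.
  by move=> /dF[+ _] => /derivable1_diffP /differentiable_continuous.
have cf (t : R) : 0 < t -> {for t, continuous f}.
  move=> t0; apply: cvgB; last exact: continuous_gammaf.
  by apply: cvgM; [exact: cvg_cst | exact: continuous_gammaf].
have /(continuous_within_itvP _ (gamma_itv_lt n))[_ Fl Fr] :=
  @within_gamma_itv F n cF.
have F2 : (\int[leb]_(x in gamma_itv n) (f x)%:E =
    (F n.+2%:R)%:E - (F n.+2%:R^-1)%:E)%E.
  apply: continuous_FTC2 => //.
  - exact: gamma_itv_lt.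
  - exact: within_gamma_itv.
  - split => // t; rewrite in_itv/= => /andP[t0 _].
    by have [] : is_derive t 1 F (f t) by apply: dF; exact: lt_trans t0.
  - move=> t; rewrite in_itv/= => /andP[t0 _]; rewrite derive1E.
    by have [] : is_derive t 1 F (f t) by apply: dF; exact: lt_trans t0.
rewrite -integralZl//; last exact: integrable_gamma_itv.
apply/eqP; rewrite EFinB -/(F _) -/(F _) -F2 addeC -sube_eq.
- rewrite -integralB//; last exact: integrable_gamma_itv.
  by apply: integrableZl => //; exact: integrable_gamma_itv.
- by apply: integrable_fin_num => //; apply: integrableZl => //; exact: integrable_gamma_itv.
- apply: fin_num_adde_defl; apply: integrable_fin_num => //; exact: integrable_gamma_itv.
Qed.

Lemma bigcup_gamma_itv : \bigcup_n gamma_itv n = `]0, +oo[%classic :> set R.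
Proof.
apply/seteqP; split => t /=; first by move=> [n _ /gamma_itv_gt0]; rewrite in_itv/= andbT.
rewrite in_itv/= andbT => t0.
exists (maxn (Num.truncn t) (Num.truncn t^-1)) => //.
rewrite /gamma_itv /= in_itv/=; apply/andP; split.
  rewrite invf_ple ?posrE// ltW// (lt_le_trans (truncnS_gt _))// ler_nat.
  by rewrite ltnS leqW// leq_maxr.
rewrite ltW// (lt_le_trans (truncnS_gt _))// ler_nat.
by rewrite ltnS leqW// leq_maxl.
Qed.

Lemma cvg_integral_gamma_itv s :
  (\int[leb]_(t in gamma_itv n) (gammaf s t)%:E @[n --> \oo] -->
   \int[leb]_(t in `]0%R, +oo[) (gammaf s t)%:E)%E.
Proof.
rewrite -bigcup_gamma_itv; apply: ge0_nondecreasing_set_cvg_integral.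
- move=> m n mn; rewrite subsetEset => t; rewrite /gamma_itv /= !in_itv/= => /andP[h1 h2].
  rewrite (le_trans _ h1) ?(le_trans h2)//= ?ler_nat ?lef_pV2 ?posrE//.
  by rewrite ler_nat.
- by move=> n; exact: measurable_itv.
- move=> n; apply/measurable_EFinP/measurable_funTS; exact: measurable_gammaf.
- by move=> n t _; rewrite lee_fin gammaf_ge0.
Qed.

Lemma cvg_powR_expRN (s : R) :
  powR n.+2%:R s * expR (- n.+2%:R) @[n --> \oo] --> (0 : R).
Proof.
pose k := (Num.truncn s).+1.
apply: (@squeeze_cvgr _ _ _ _ (fun=> 0) (fun n => k.+1`!%:R * n.+1%:R^-1)).
- apply: nearW => n; rewrite mulr_ge0 ?powR_ge0 ?expR_ge0//=.
  rewrite expRN ler_pdivrMr ?expR_gt0//.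
  have n0 : (0 : R) < n.+2%:R by [].
  apply: (@le_trans _ _ (n.+2%:R ^+ k)).
    rewrite -powR_mulrn// ler_powR ?ler1n// ltW//.
    exact: truncnS_gt.
  (* A single term of the exponential series, of degree [k + 1], beats [t ^ k] by a factor [t]. *)
  have := @expR_ge1Dxn R n.+2%:R k (ltW n0).
  move=> h; have {h} : n.+2%:R ^+ k.+1 / k.+1`!%:R <= expR n.+2%:R :> R.
    by apply: le_trans h; rewrite lerDr.
  rewrite ler_pdivrMr ?ltr0n ?fact_gt0// => h.
  rewrite mulrAC ler_pdivlMr ?ltr0n//.
  apply: le_trans (_ : n.+2%:R ^+ k.+1 <= _); last by rewrite mulrC.
  by rewrite exprSr ler_wpM2l ?exprn_ge0// ler_nat.
- exact: cvg_cst.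
- rewrite -(mulr0 k.+1`!%:R); apply: cvgM; first exact: cvg_cst.
  exact: cvg_harmonic.
Qed.

Lemma cvg_powRV_expRN (s : R) : 0 < s ->
  powR n.+2%:R^-1 s * expR (- n.+2%:R^-1) @[n --> \oo] --> (0 : R).
Proof.
move=> s0.
have c : n.+2%:R^-1 @[n --> \oo] --> (0 : R).
  by have := @cvg_harmonic R; rewrite -cvg_shiftS.
apply: (@squeeze_cvgr _ _ _ _ (fun=> 0) (fun n => powR n.+2%:R^-1 s)).
- apply: nearW => n; rewrite mulr_ge0 ?powR_ge0 ?expR_ge0//=.
  by rewrite ler_piMr ?powR_ge0// expR_le1 oppr_le0 invr_ge0.
- exact: cvg_cst.
- have /cvg_at_rightP := @powR_cvg0 R s s0; by apply; split.
Qed.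

(** An identity of extended reals, so that it can precede finiteness, which is then derived from
    it. *)
Lemma gamma_recE s : 0 < s ->
  (\int[leb]_(t in `]0%R, +oo[) (gammaf (s + 1) t)%:E =
  s%:E * \int[leb]_(t in `]0%R, +oo[) (gammaf s t)%:E)%E.
Proof.
move=> s0.
have h1 : (s%:E * \int[leb]_(t in gamma_itv n) (gammaf s t)%:E @[n --> \oo] -->
   s%:E * \int[leb]_(t in `]0%R, +oo[) (gammaf s t)%:E)%E.
  by apply: cvgeZl => //; exact: cvg_integral_gamma_itv.
have h2 : (s%:E * \int[leb]_(t in gamma_itv n) (gammaf s t)%:E @[n --> \oo] -->
   \int[leb]_(t in `]0%R, +oo[) (gammaf (s + 1) t)%:E)%E.
  under eq_fun do rewrite integral_gamma_itv.
  rewrite -[X in nbhs X]adde0; apply: cvgeD.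
  - by rewrite fin_num_adde_defl.
  - exact: cvg_integral_gamma_itv.
  - apply: cvg_EFin; first exact: nearW.
    rewrite -(subrr 0); apply: cvgB; first exact: cvg_powR_expRN.
    exact: cvg_powRV_expRN.
exact: (cvg_unique _ h2 h1).
Qed.

Lemma measurable_gammaf_itv s : measurable_fun (`]0, +oo[ : set R) (EFin \o gammaf s).
Proof. by apply/measurable_EFinP/measurable_funTS; exact: measurable_gammaf. Qed.

Lemma integral_gammaf1_lty : (\int[leb]_(t in `]0%R, +oo[) (gammaf 1 t)%:E < +oo)%E.
Proof.
have -> : (\int[leb]_(t in `]0%R, +oo[) (gammaf 1 t)%:E =
    \int[leb]_(t in `[0%R, +oo[) (expR (- t))%:E)%E.
  rewrite -integral_itv_obnd_cbnd; last first.
    apply/measurable_EFinP/measurable_funTS.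
    by apply: measurableT_comp => //; exact: measurable_funN.
  by apply: eq_integral => t _; rewrite /gammaf subrr powRr0 mul1r.
rewrite (@ge0_continuous_FTC2y _ (fun t => expR (- t)) (fun t => - expR (- t)) 0 0)//.
- by rewrite ltey.
- apply: continuous_subspaceT => t; apply: continuous_comp; first exact: opp_continuous.
  exact: continuous_expR.
- by rewrite -oppr0; apply: cvgN; exact: cvgr_expR.
- apply: cvg_at_right_filter; apply: cvgN.
  apply: continuous_comp; first exact: opp_continuous.
  exact: continuous_expR.
- move=> t t0; rewrite derive1E.
  have : is_derive t 1 (fun t : R => - expR (- t)) (expR (- t)).
    by apply: is_derive_eq; rewrite /GRing.scale/=; ring.
  by case.
Qed.

Lemma integral_gammaf_nat_lty n :
  (\int[leb]_(t in `]0%R, +oo[) (gammaf n.+1%:R t)%:E < +oo)%E.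
Proof.
elim: n => [|n ih]; first exact: integral_gammaf1_lty.
by rewrite -natr1 gamma_recE// lte_mul_pinfty// ?lee_fin.
Qed.

Lemma integral_gammaf_lty s : 0 < s ->
  (\int[leb]_(t in `]0%R, +oo[) (gammaf s t)%:E < +oo)%E.
Proof.
(* Multiplying by [s] raises the exponent by one: [t ^ s] has no singularity at 0 and is at most
   [1 + t ^ k.+1], which leaves Gamma integrals at positive integers. *)
move=> s0; rewrite -(@lte_pmul2l _ s%:E)// ?lte_fin// mulry gtr0_sg// mul1e -gamma_recE//.
pose k := Num.truncn s.
apply: (@le_lt_trans _ _ (\int[leb]_(t in `]0%R, +oo[)
    ((gammaf 1 t)%:E + (gammaf k.+2%:R t)%:E)))%E.
  apply: ge0_le_integral => //.
  - by move=> t _; rewrite lee_fin gammaf_ge0.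
  - exact: measurable_gammaf_itv.
  - by apply: emeasurable_funD; exact: measurable_gammaf_itv.
  - move=> t; rewrite /= in_itv/= andbT => t0; rewrite lee_fin /gammaf addrK -mulrDl.
    rewrite ler_wpM2r ?expR_ge0// subrr powRr0 -[k.+2%:R]natr1 addrK.
    have [t1|t1] := leP t 1.
      apply: (@le_trans _ _ 1); last by rewrite lerDl powR_ge0.
      by rewrite -(powRr0 t) ger_powR ?t0//= ltW.
    apply: (@le_trans _ _ (powR t k.+1%:R)); last by rewrite lerDr.
    by rewrite ler_powR ?ltW// truncnS_gt.
rewrite ge0_integralD//; try exact: measurable_gammaf_itv; last 2 first.
- by move=> t _; rewrite lee_fin gammaf_ge0.
- by move=> t _; rewrite lee_fin gammaf_ge0.
by rewrite lte_add_pinfty// ?integral_gammaf1_lty ?integral_gammaf_nat_lty.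
Qed.

Lemma GammaE s : 0 < s ->
  (Gamma s)%:E = (\int[leb]_(t in `]0%R, +oo[) (gammaf s t)%:E)%E.
Proof.
move=> s0; rewrite /Gamma fineK// ge0_fin_numE ?integral_gammaf_lty//.
by apply: integral_ge0 => t _; rewrite lee_fin gammaf_ge0.
Qed.

Lemma GammaD1 (s : R) : 0 < s -> Gamma (s + 1) = s * Gamma s.
Proof.
by move=> s0; apply: EFin_inj; rewrite EFinM !GammaE ?addr_gt0// gamma_recE.
Qed.

Lemma Gamma_gt0 (s : R) : 0 < s -> 0 < Gamma s.
Proof.
move=> s0; rewrite lt_neqAle; apply/andP; split; last first.
  by apply: fine_ge0; apply: integral_ge0 => t _; rewrite lee_fin gammaf_ge0.
apply/eqP => G0; have := GammaE s0; rewrite -G0 => /esym I0.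
have : (\int[leb]_(t in `]0%R, +oo[) `|(EFin \o gammaf s) t| = 0)%E.
  apply: etrans I0; apply: eq_integral => t _.
  by rewrite gee0_abs// lee_fin gammaf_ge0.
move=> /ae_eq_integral_abs => /(_ (measurable_itv _) (measurable_gammaf_itv s)).
move=> [A [mA A0 sA]].
suff : (leb `]0%R, 1%R[ <= 0)%E.
  by rewrite lebesgue_measure_itv/= lte_fin ltr01 sube0 lee_fin ler10.
rewrite -A0; apply: le_measure; rewrite ?inE//.
apply: subset_trans sA => t /=; rewrite in_itv/= => /andP[t0 t1].
move=> /(_ _)/= h; have /h [] : t \in `]0, +oo[ by rewrite in_itv/= t0.
by apply/eqP; rewrite mulf_neq0// ?gt_eqF ?powR_gt0 ?expR_gt0.
Qed.
End GammaFunction.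

(** * Integrals over the sphere and moments of a coordinate *)

Section SphereIntegral.
Context {R : realType} {N : nat}.
Implicit Types (mu nu : probability (vec R N) R) (x y : vec R N).
Local Notation S := (@sphere R N).

Lemma measurable_dotp x : measurable_fun setT (dotp x).
Proof.
rewrite /dotp; apply: measurable_sum => i.
by apply: measurable_funM => //; exact: measurable_tnth.
Qed.

Lemma measurable_sphere : measurable S.
Proof.
have m : measurable_fun setT (fun y : vec R N => dotp y y).
  rewrite /dotp; apply: measurable_sum => i.
  by apply: measurable_funM => //; exact: measurable_tnth.
have -> : S = setT `&` (fun y : vec R N => dotp y y) @^-1` [set 1].
  by rewrite setTI.
exact: m.
Qed.
#[local] Hint Resolve measurable_sphere : core.

Lemma le_dotp_sphere x y : S x -> S y -> `|dotp x y| <= 1.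
Proof.
rewrite /sphere /= => x1 y1.
(* Expand the squared norm of [x - s y]; the signs [s = 1] and [s = -1] give the two bounds. *)
have h (s : R) : s ^+ 2 = 1 -> 2 * (s * dotp x y) <= 2.
  move=> s1; rewrite -subr_ge0.
  have -> : 2 - 2 * (s * dotp x y) = \sum_(i < N) (tnth x i - s * tnth y i) ^+ 2.
    rewrite (eq_bigr (fun i => tnth x i * tnth x i + tnth y i * tnth y i
       - 2 * s * (tnth x i * tnth y i))); last first.
      by move=> i _; rewrite sqrrB exprMn s1 mul1r !expr2; ring.
    rewrite sumrB big_split/= -mulr_sumr -/(dotp x x) -/(dotp y y) -/(dotp x y) x1 y1.
    ring.
  by apply: sumr_ge0 => i _; exact: sqr_ge0.
have h1 := h 1 (expr1n _ _).
have h2 : 2 * (-1 * dotp x y) <= 2 by apply: h; rewrite sqrrN expr1n.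
rewrite ler_norml; apply/andP; split; lra.
Qed.

Lemma sphere_coord_le1 y i : S y -> `|tnth y i| <= 1.
Proof.
rewrite /sphere /= => y1; rewrite -sqrtr_sqr -[leRHS]sqrtr1 ler_wsqrtr//.
rewrite -y1 /dotp (bigD1 i)//= expr2 lerDl sumr_ge0// => j _.
by rewrite -expr2 sqr_ge0.
Qed.

Lemma integrable_sphere nu (g : vec R N -> R) (M : R) : measurable_fun setT g ->
  (forall y, S y -> `|g y| <= M) -> nu.-integrable S (EFin \o g).
Proof.
move=> mg gM; apply: measurable_bounded_integrable => //.
- by rewrite (le_lt_trans (probability_le1 _ _))// ltry.
- exact: measurable_funTS.
- exists M; split => //; first exact: num_real.
  by move=> K MK y /= Sy; rewrite (le_trans (gM _ Sy))// ltW.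
Qed.

Lemma integrable_RZl nu (a : R) (g : vec R N -> R) : nu.-integrable S (EFin \o g) ->
  nu.-integrable S (EFin \o (fun y => a * g y)).
Proof. by move=> ig; have := integrableZl measurable_sphere a ig. Qed.

Lemma integrable_RB nu (g h : vec R N -> R) : nu.-integrable S (EFin \o g) ->
  nu.-integrable S (EFin \o h) -> nu.-integrable S (EFin \o (fun y => g y - h y)).
Proof. by move=> ig ih; have := integrableB measurable_sphere ig ih. Qed.

(** The entropy integrates over the whole space and the mean over the sphere; this brings both to
    the sphere. *)
Lemma integral_sphere nu (f : vec R N -> \bar R) : measurable_fun setT f ->
  nu S = 1%E -> (\int[nu]_y f y = \int[nu]_(y in S) f y)%E.
Proof.
move=> mf nuS; rewrite [LHS]integralE [RHS]integralE.
have nS : nu (~` S) = 0%E by rewrite probability_setC ?nuS ?subee.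
by congr (_ - _)%E; rewrite (@ge0_negligible_integral _ _ _ _ _ (~` S))// ?setTD ?setCK//;
  [exact: measurableC|exact: measurable_funepos|exact: measurableC|exact: measurable_funeneg].
Qed.

Lemma measurable_rotate (O : 'M[R]_N) : measurable_fun setT (@rotate R N O).
Proof.
apply/measurable_fun_tnthP => i.
rewrite (_ : _ \o _ = fun x => \sum_(j < N) tnth x j * O j i); last first.
  by apply/funext => x /=; rewrite tnth_mktuple.
apply: measurable_sum => j.
by apply: measurable_funM => //; exact: measurable_tnth.
Qed.

Definition rowv x : 'rV[R]_N := \row_j tnth x j.

Lemma dotpE x y : (rowv x *m (rowv y)^T) 0 0 = dotp x y.
Proof. by rewrite mxE; apply: eq_bigr => i _; rewrite !mxE. Qed.

Lemma rowv_rotate O x : rowv (rotate O x) = rowv x *m O.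
Proof.
by apply/rowP => i; rewrite !mxE tnth_mktuple; apply: eq_bigr => j _; rewrite mxE.
Qed.

Lemma dotp_rotate (O : 'M[R]_N) x y : O *m O^T = 1%:M ->
  dotp (rotate O x) (rotate O y) = dotp x y.
Proof.
by move=> OO; rewrite -!dotpE !rowv_rotate trmx_mul mulmxA -(mulmxA _ O) OO mulmx1.
Qed.

Lemma Rintegral_rotate mu (O : 'M[R]_N) (g : vec R N -> R) (M : R) :
  is_uniform_sphere mu -> O *m O^T = 1%:M ->
  measurable_fun setT g -> (forall y, S y -> `|g y| <= M) ->
  \int[mu]_(y in S) g (rotate O y) = \int[mu]_(y in S) g y.
Proof.
move=> [muS rot] OO mg gM; congr fine.
have SO : rotate O @^-1` S = S.
  by apply/seteqP; split => y; rewrite /sphere /= dotp_rotate.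
have mO := measurable_rotate O.
rewrite -[LHS]/(\int[mu]_(y in S) ((EFin \o g) \o rotate O) y)%E -[in LHS]SO.
rewrite -integral_pushforward//.
- apply: eq_measure_integral => A mA _; exact: rot.
- exact/measurable_EFinP.
- rewrite SO; apply: (@integrable_sphere _ _ M).
    exact: measurableT_comp.
  by move=> y; rewrite -{1}SO => /gM.
Qed.

(** The reflection along [w = x - e_i] exchanges [x] with the basis vector [e_i], so its [i]-th
    column is [x]. If the [i]-th coordinate of [x] is 1, then [w = 0] and the identity is taken. *)
Lemma householder x i : S x -> exists O' : 'M[R]_N, O' *m O'^T = 1%:M /\
  forall y, tnth (rotate O' y) i = dotp x y.
Proof.
move=> x1.
have [xi1|xi1] := eqVneq (tnth x i) 1.
  exists 1%:M; split; first by rewrite trmx1 mulmx1.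
  move=> y.
  have xj j : j != i -> tnth x j = 0.
    move=> ji; apply/eqP; rewrite -sqrf_eq0 eq_le sqr_ge0 andbT.
    have : dotp x x = 1 := x1.
    rewrite /dotp (bigD1 i)//= (bigD1 j)//= xi1 mulr1 -expr2.
    have : 0 <= \sum_(k < N | (k != i) && (k != j)) tnth x k * tnth x k.
      by apply: sumr_ge0 => k _; rewrite -expr2 sqr_ge0.
    lra.
  rewrite tnth_mktuple /dotp (bigD1 i)//= [RHS](bigD1 i)//= !mxE eqxx mulr1 xi1 mul1r.
  congr (_ + _); rewrite !big1// => j ji; rewrite ?xj ?mul0r//.
  by rewrite mxE (negbTE ji) mulr0.
have d0 : 1 - tnth x i != 0 by rewrite subr_eq0 eq_sym.
pose w : 'rV[R]_N := \row_j (tnth x j - (j == i)%:R).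
(* This is [2 / |w|^2], because [|w|^2 = 2 (1 - x_i)] for a unit vector [x]. *)
pose a := (1 - tnth x i)^-1.
pose O : 'M[R]_N := 1%:M - a *: (w^T *m w).
have OT : O^T = O by rewrite /O linearB/= linearZ/= trmx_mul trmxK trmx1.
have ww : w *m w^T = (2 / a)%:M.
  rewrite [LHS]mx11_scalar; congr (_%:M).
  rewrite mxE (eq_bigr (fun j => tnth x j * tnth x j
      + (j == i)%:R * (1 - 2 * tnth x i))); last first.
    move=> j _; rewrite !mxE; case: eqVneq => [->|_] /=; ring.
  rewrite big_split/= -/(dotp x x) x1 (bigD1 i)//= eqxx big1; last first.
    by move=> j /negbTE ->; rewrite mul0r.
  rewrite /a invrK mul1r addr0; ring.
have a0 : a != 0 by rewrite invr_eq0.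
exists O; split.
  have PP : w^T *m w *m (w^T *m w) = (2 / a) *: (w^T *m w).
    by rewrite mulmxA -(mulmxA w^T) ww mul_mx_scalar -scalemxAl.
  rewrite OT /O; set P := w^T *m w in PP *.
  rewrite mulmxBl mul1mx mulmxBr mulmx1 -scalemxAl -!scalemxAr PP !scalerA.
  have -> : a * a * (2 / a) = a + a by field.
  by rewrite scalerDl opprB addrK subrK.
move=> y; rewrite tnth_mktuple; apply: eq_bigr => j _.
rewrite mulrC; congr (_ * _).
rewrite !mxE big_ord1 !mxE eqxx /a.
by case: eqVneq => [->|_] /=; field.
Qed.

(** All one-dimensional projections of [mu] have the same law, by an orthogonal map exchanging [x]
    with a basis vector. *)
Lemma Rintegral_dotp mu x i (F : R -> R) (M : R) :
  is_uniform_sphere mu -> S x -> measurable_fun setT F ->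
  (forall t, `|t| <= 1 -> `|F t| <= M) ->
  \int[mu]_(y in S) F (dotp x y) = \int[mu]_(y in S) F (tnth y i).
Proof.
move=> mu_unif Sx mF FM; have [V [VV Vi]] := householder i Sx.
rewrite -[RHS](@Rintegral_rotate mu V (fun y => F (tnth y i)) M)//.
- by apply: eq_Rintegral => y _; rewrite Vi.
- by apply: measurableT_comp => //; exact: measurable_tnth.
- by move=> y Sy; apply: FM; exact: sphere_coord_le1.
Qed.

(** * Moments of a coordinate of a uniform point *)

Definition mom mu i k : R := \int[mu]_(y in S) tnth y i ^+ k.

Lemma measurable_coordX i k : measurable_fun setT (fun y : vec R N => tnth y i ^+ k).
Proof. by apply: measurable_funX; exact: measurable_tnth. Qed.

Lemma sphere_coordX_le1 i k y : S y -> `|tnth y i ^+ k| <= 1.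
Proof. by move=> Sy; rewrite normrX exprn_ile1// sphere_coord_le1. Qed.

Lemma integrable_coordXX nu i j k l :
  nu.-integrable S (EFin \o (fun y => tnth y i ^+ k * tnth y j ^+ l)).
Proof.
apply: (@integrable_sphere _ _ 1).
  by apply: measurable_funM; exact: measurable_coordX.
by move=> y Sy; rewrite normrM -(mulr1 1) ler_pM// sphere_coordX_le1.
Qed.

Lemma mom_pair mu i j k (c : R) : is_uniform_sphere mu -> i != j ->
  \int[mu]_(y in S) (tnth y i + c * tnth y j) ^+ (2 * k) =
  (1 + c ^+ 2) ^+ k * mom mu i (2 * k).
Proof.
move=> mu_unif ij.
have c0 : 0 < 1 + c ^+ 2 by rewrite ltr_wpDr// sqr_ge0.
pose r := Num.sqrt (1 + c ^+ 2).
have r0 : r != 0 by rewrite gt_eqF// sqrtr_gt0.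
have r2 : r ^+ 2 = 1 + c ^+ 2 by rewrite sqr_sqrtr// ltW.
(* The unit vector along [e_i + c e_j]. *)
pose x : vec R N := [tuple ((l == i)%:R + c * (l == j)%:R) / r | l < N].
have xE y : dotp x y = (tnth y i + c * tnth y j) / r.
  rewrite /dotp (bigD1 i)//= (bigD1 j)//= ?big1 1?eq_sym//; last first.
    move=> l /andP[/negbTE li /negbTE lj].
    by rewrite tnth_mktuple li lj mulr0 addr0 mul0r mul0r.
  rewrite !tnth_mktuple !eqxx (negbTE ij) eq_sym (negbTE ij) /=.
  by field.
have Sx : S x.
  rewrite /sphere /= xE !tnth_mktuple !eqxx (negbTE ij) eq_sym (negbTE ij) /=.
  rewrite mulr0 mulr1 addr0 add0r mulrA -mulrDl -expr2 -r2.
  by field.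
have := @Rintegral_dotp mu x i (fun t => t ^+ (2 * k)) 1 mu_unif Sx.
rewrite -/(mom _ _ _) => <-; last 2 first.
- exact: exprn_measurable.
- by move=> t t1; rewrite normrX exprn_ile1.
rewrite -r2 -exprM -RintegralZl//; last first.
  apply: (@integrable_sphere _ _ 1).
    by apply: measurable_funX; exact: measurable_dotp.
  by move=> y Sy; rewrite normrX exprn_ile1// le_dotp_sphere.
by apply: eq_Rintegral => y _; rewrite xE -exprMn [r * _]mulrC divfK.
Qed.

Lemma Rintegral_sphere_sum nu (I : Type) (s : seq I) (f : I -> vec R N -> R) :
  (forall l, nu.-integrable S (EFin \o f l)) ->
  \int[nu]_(y in S) \sum_(l <- s) f l y = \sum_(l <- s) \int[nu]_(y in S) f l y.
Proof.
move=> fi; elim: s => [|l s ih].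
  rewrite big_nil; under eq_Rintegral do rewrite big_nil.
  by rewrite Rintegral_cst// mul0r.
rewrite big_cons -ih -RintegralD//.
  by apply: eq_Rintegral => y _; rewrite big_cons.
rewrite (_ : _ \o _ = fun y => (\sum_(l <- s) (EFin \o f l) y)%E).
  by apply: integrable_sum => // t _; exact: fi.
by apply/funext => y /=; rewrite sumEFin.
Qed.

Lemma poly_horner_inj (p q : {poly R}) : (forall c, p.[c] = q.[c]) -> p = q.
Proof.
move=> pq; apply/eqP; rewrite -subr_eq0; apply/eqP.
apply: (@roots_geq_poly_eq0 _ _ [seq n%:R | n <- iota 0 (size (p - q))]).
- by apply/allP => c _; rewrite /root hornerD hornerN pq subrr.
- by rewrite map_inj_uniq ?iota_uniq//; exact: mulrIn.
- by rewrite size_map size_iota.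
Qed.

Lemma coef2_1DX2_expn k : (((1 + 'X^2) ^+ k : {poly R})`_2) = k%:R.
Proof.
have h : ((1 + 'X^2) ^+ k : {poly R})`_0 = 1 /\ ((1 + 'X^2) ^+ k : {poly R})`_2 = k%:R.
  elim: k => [|k [h0 h2]]; first by rewrite expr0 !coef1.
  by rewrite exprSr mulrDr mulr1 !coefD !coefMXn/= h0 h2 addr0 natr1.
exact: h.2.
Qed.

(* Both sides of [mom_pair] are polynomials in [c]; compare the coefficients of [c^2]. *)
Lemma mom_mixed mu i j k : is_uniform_sphere mu -> i != j ->
  (2 * k).+1%:R * \int[mu]_(y in S) (tnth y i ^+ (2 * k) * tnth y j ^+ 2) =
  mom mu i (2 * k.+1).
Proof.
move=> mu_unif ij.
pose n := (2 * k.+1)%N.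
pose M l := \int[mu]_(y in S) (tnth y i ^+ (n - l) * tnth y j ^+ l).
pose p : {poly R} := \poly_(l < n.+1) (M l *+ 'C(n, l)).
pose q : {poly R} := mom mu i n *: (1 + 'X^2) ^+ k.+1.
have pq : p = q.
  apply: poly_horner_inj => c.
  rewrite /q hornerE horner_exp !hornerE mulrC -(mom_pair k.+1 c mu_unif ij).
  rewrite /p horner_poly -/n.
  have ti l : mu.-integrable S (EFin \o (fun y => c ^+ l *+ 'C(n, l) *
      (tnth y i ^+ (n - l) * tnth y j ^+ l))).
    have := integrableZl measurable_sphere (c ^+ l *+ 'C(n, l))
      (integrable_coordXX mu i j (n - l) l).
    by apply: eq_integrable => // y _; rewrite EFinM.
  rewrite (@eq_Rintegral _ _ _ mu S (fun y => \sum_(l < n.+1) c ^+ l *+ 'C(n, l) *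
      (tnth y i ^+ (n - l) * tnth y j ^+ l))); last first.
    move=> y _; rewrite exprDn; apply: eq_bigr => l _.
    by rewrite exprMn mulrnAl; congr (_ *+ _); ring.
  rewrite Rintegral_sphere_sum//.
  apply: eq_bigr => l _; rewrite RintegralZl//; last exact: integrable_coordXX.
  by rewrite -/(M l) !mulrnAl mulrC.
have := congr1 (fun p : {poly R} => p`_2) pq.
rewrite /p /q coef_poly coefZ coef2_1DX2_expn.
have -> : (2 < n.+1)%N by rewrite /n mulnS ltnS leq_addr.
have nB : (n - 2)%N = (2 * k)%N by rewrite /n mulnS addKn.
have C2 : 'C(n, 2)%:R = k.+1%:R * (2 * k).+1%:R :> R.
  apply: (@mulfI _ 2) => //; rewrite -!natrM -(mul_bin_diag n 1) bin1; congr (_%:R).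
  by rewrite (_ : n.-1 = (2 * k).+1) ?mulnA// /n mulnS.
rewrite -[_ *+ 'C(n, 2)]mulr_natr C2 /M nB => h.
have k0 : k.+1%:R != 0 :> R by rewrite pnatr_eq0.
apply: (mulIf k0); rewrite -h; ring.
Qed.

Lemma sum_coord_sqr y : S y -> \sum_(j < N) tnth y j ^+ 2 = 1.
Proof. by rewrite /sphere /= => <-; apply: eq_bigr => j _; rewrite expr2. Qed.

(** Insert [1 = \sum_j y_j ^ 2]: the term [j = i] is the next even moment, and each of the [N - 1]
    others is that moment divided by [2 k + 1]. *)
Lemma mom_rec mu i k : is_uniform_sphere mu ->
  (2 * k + N)%:R * mom mu i (2 * k.+1) = (2 * k).+1%:R * mom mu i (2 * k).
Proof.
move=> mu_unif.
have -> : mom mu i (2 * k) =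
    \sum_(j < N) \int[mu]_(y in S) (tnth y i ^+ (2 * k) * tnth y j ^+ 2).
  rewrite -Rintegral_sphere_sum//; last by move=> j; exact: integrable_coordXX.
  apply: eq_Rintegral => y; rewrite inE => Sy.
  by rewrite -mulr_sumr sum_coord_sqr// mulr1.
have ii : \int[mu]_(y in S) (tnth y i ^+ (2 * k) * tnth y i ^+ 2) = mom mu i (2 * k.+1).
  by apply: eq_Rintegral => y _; rewrite -exprD mulnS addnC.
rewrite (bigD1 i)//= ii mulrDr mulr_sumr.
rewrite (eq_bigr (fun=> mom mu i (2 * k.+1))); last first.
  by move=> j ji; rewrite mom_mixed// eq_sym.
rewrite sumr_const cardC1 card_ord -[_ *+ N.-1]mulr_natl -mulrDl -natrD; congr (_%:R * _).
by have := ltn_ord i; lia.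
Qed.

Lemma mom_odd mu i k : is_uniform_sphere mu -> mom mu i (2 * k).+1 = 0.
Proof.
move=> mu_unif.
have OO : (- 1%:M : 'M[R]_N) *m (- 1%:M)^T = 1%:M.
  by rewrite linearN/= trmx1 mulmxN mulNmx mulmx1 opprK.
have := @Rintegral_rotate mu _ (fun y => tnth y i ^+ (2 * k).+1) 1 mu_unif OO
  (measurable_coordX i _) (sphere_coordX_le1 i _).
rewrite -/(mom mu i _) => h; suff : mom mu i (2 * k).+1 = - mom mu i (2 * k).+1 by lra.
rewrite -{1}h -[- mom _ _ _]mulN1r /mom -RintegralZl//; last first.
  by apply: (@integrable_sphere _ _ 1); [exact: measurable_coordX|exact: sphere_coordX_le1].
apply: eq_Rintegral => y _; rewrite mulN1r.
have -> : tnth (rotate (- 1%:M) y) i = - tnth y i.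
  rewrite tnth_mktuple (bigD1 i)//= big1 ?addr0; last first.
    by move=> j /negbTE ji; rewrite !mxE ji oppr0 mulr0.
  by rewrite !mxE eqxx mulrN1.
by rewrite exprNn -signr_odd/= mul2n odd_double/= expr1 mulN1r.
Qed.

Lemma mom0 mu i : mu S = 1%E -> mom mu i 0 = 1.
Proof.
move=> muS; rewrite /mom (@eq_Rintegral _ _ _ _ _ (cst 1))//.
by rewrite Rintegral_cst// mul1r; exact: (congr1 fine muS).
Qed.

End SphereIntegral.

#[local] Hint Extern 0 (measurable _) => solve [exact: measurable_sphere] : core.

(** * The moment generating function *)

Section SeriesParity.
Context {R : realType}.
Implicit Types (u v : R^nat).

Lemma series_scale b u n : b * series u n = series (fun k => b * u k) n.
Proof. by rewrite /series /= mulr_sumr. Qed.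

Lemma series_even u v n : (forall k, u (2 * k).+1 = 0) -> (forall k, u (2 * k)%N = v k) ->
  series u (2 * n)%N = series v n.
Proof.
move=> u1 u0; rewrite /series /=; elim: n => [|n ih]; first by rewrite muln0 !big_geq.
by rewrite mulnS add2n !big_nat_recr//= ih  u1 addr0 u0.
Qed.

Lemma series_odd u v n : (forall k, u (2 * k)%N = 0) -> (forall k, u (2 * k).+1 = v k) ->
  series u (2 * n)%N = series v n.
Proof.
move=> u0 u1; rewrite /series /=; elim: n => [|n ih]; first by rewrite muln0 !big_geq.
by rewrite mulnS add2n !big_nat_recr//= ih  u1 u0 addr0.
Qed.

End SeriesParity.

Section SphereMGF.
Context {R : realType} {N : nat}.
Implicit Types (mu nu : probability (vec R N) R).
Local Notation S := (@sphere R N).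

Lemma cvg_series_expR (x : R) : series (exp_coeff x) n @[n --> \oo] --> expR x.
Proof. exact: is_cvg_series_exp_coeff. Qed.

(** Termwise domination of the remainder. It makes the exponential series converge uniformly on the
    sphere, hence allows integration term by term in [cvg_mgfn]. *)
Lemma expR_series_dist (x B : R) n : `|x| <= B ->
  `|expR x - series (exp_coeff x) n| <= expR B - series (exp_coeff B) n.
Proof.
move=> xB.
have h : `|series (exp_coeff x) k - series (exp_coeff x) n| @[k --> \oo] -->
    `|expR x - series (exp_coeff x) n|.
  by apply: cvg_norm; apply: cvgB; [exact: cvg_series_expR|exact: cvg_cst].
have h' : series (exp_coeff B) k - series (exp_coeff B) n @[k --> \oo] -->
    expR B - series (exp_coeff B) n.
  by apply: cvgB; [exact: cvg_series_expR|exact: cvg_cst].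
apply: (ler_cvg_to h h'); exists n => // k /= nk.
rewrite !sub_series_geq// (le_trans (ler_norm_sum _ _ _))//.
apply: ler_sum => l _; rewrite /exp_coeff /= normrM normrX.
rewrite (@ger0_norm _ (l`!%:R^-1)) ?invr_ge0// ler_wpM2r ?invr_ge0//.
by rewrite lerXn2r ?nnegrE// (le_trans _ xB).
Qed.

(** For [e = 0] this is the moment generating function of a coordinate, for larger [e] its [e]-th
    derivative. *)
Definition mgfn mu i (e : nat) (b : R) : R :=
  \int[mu]_(y in S) (tnth y i ^+ e * expR (b * tnth y i)).

Lemma measurable_mgfn i e (b : R) :
  measurable_fun setT (fun y : vec R N => tnth y i ^+ e * expR (b * tnth y i)).
Proof.
apply: measurable_funM; first exact: measurable_coordX.
apply: measurableT_comp => //; apply: measurable_funM => //.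
exact: measurable_tnth.
Qed.

Lemma mgfn_bound i e (b : R) (y : vec R N) : S y ->
  `|tnth y i ^+ e * expR (b * tnth y i)| <= expR `|b|.
Proof.
move=> Sy; rewrite normrM -[leRHS]mul1r ler_pM ?sphere_coordX_le1//.
rewrite ger0_norm ?expR_ge0// ler_expR (le_trans (ler_norm _))// normrM.
by rewrite ler_piMr// sphere_coord_le1.
Qed.

Lemma integrable_mgfn nu i e b :
  nu.-integrable S (EFin \o (fun y : vec R N => tnth y i ^+ e * expR (b * tnth y i))).
Proof.
apply: (@integrable_sphere R N _ _ (expR `|b|)); first exact: measurable_mgfn.
by move=> y; exact: mgfn_bound.
Qed.

Lemma cvg_mgfn mu i e (b : R) : mu S = 1%E ->
  series (fun k => b ^+ k / k`!%:R * mom mu i (e + k)) n @[n --> \oo] --> mgfn mu i e b.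
Proof.
move=> muS.
pose s n y := tnth y i ^+ e * series (exp_coeff (b * tnth y i)) n.
have sE n y : s n y = \sum_(k <- index_iota 0 n) b ^+ k / k`!%:R * tnth y i ^+ (e + k).
  rewrite /s /series /= mulr_sumr; apply: eq_bigr => k _.
  by rewrite /exp_coeff /= exprMn exprD; ring.
have ti k : mu.-integrable S (EFin \o (fun y : vec R N => b ^+ k / k`!%:R * tnth y i ^+ (e + k))).
  apply: (@integrable_sphere R N _ _ `|b ^+ k / k`!%:R|).
    by apply: measurable_funM => //; exact: measurable_coordX.
  by move=> y Sy; rewrite normrM ler_piMr// sphere_coordX_le1.
have is_ n : mu.-integrable S (EFin \o s n).
  rewrite (_ : _ \o _ = fun y => (\sum_(k <- index_iota 0 n)
     (b ^+ k / k`!%:R * tnth y i ^+ (e + k))%:E)%E).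
    by apply: integrable_sum => // k _; exact: ti.
  by apply/funext => y /=; rewrite sumEFin sE.
have serE n : series (fun k => b ^+ k / k`!%:R * mom mu i (e + k)) n = \int[mu]_(y in S) s n y.
  rewrite [RHS](@eq_Rintegral _ _ _ mu S (fun y : vec R N => \sum_(k <- index_iota 0 n)
    b ^+ k / k`!%:R * tnth y i ^+ (e + k))); last by move=> y _; rewrite sE.
  rewrite Rintegral_sphere_sum//; apply: eq_bigr => k _; rewrite -RintegralZl//.
  apply: (@integrable_sphere R N _ _ 1); first exact: measurable_coordX.
  by move=> y; exact: sphere_coordX_le1.
have idiff n : mu.-integrable S (EFin \o (fun y : vec R N =>
    tnth y i ^+ e * expR (b * tnth y i) - s n y)).
  by have := integrableB measurable_sphere (integrable_mgfn mu i e b) (is_ n).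
apply/subr_cvg0/norm_cvg0P.
apply: (@squeeze_cvgr _ _ _ _ (fun=> 0) (fun n => expR `|b| - series (exp_coeff `|b|) n)).
- apply: nearW => n; rewrite normr_ge0 /= serE distrC -RintegralB//; last exact: integrable_mgfn.
  apply: le_trans (le_normr_Rintegral measurable_sphere (idiff n)) _.
  rewrite -[leRHS]mulr1 -(_ : fine (mu S) = 1); last exact: (congr1 fine muS).
  rewrite -Rintegral_cst//; apply: le_Rintegral => //.
  + exact: integrable_norm.
  + exact: finite_measure_integrable_cst.
  + move=> y Sy; rewrite -mulrBr normrM -[leRHS]mul1r ler_pM ?sphere_coordX_le1//.
    apply: expR_series_dist.
    by rewrite normrM ler_piMr// sphere_coord_le1.
- exact: cvg_cst.
- have : expR `|b| - series (exp_coeff `|b|) n @[n --> \oo] --> expR `|b| - expR `|b|.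
    by apply: cvgB; [exact: cvg_cst|exact: cvg_series_expR].
  by rewrite subrr.
Qed.

(** The Taylor coefficients [mom (2 k) / (2 k)!], as the product that [mom_rec] dictates;
    [sphere_coefE] rewrites them with Gamma values. *)
Definition sphere_coef (n k : nat) : R := \prod_(j < k) (2 * j.+1 * (2 * j + n))%:R^-1.

Lemma sphere_coefS n k :
  sphere_coef n k.+1 = sphere_coef n k / (2 * k.+1 * (2 * k + n))%:R.
Proof. by rewrite /sphere_coef big_ord_recr. Qed.

Lemma mom_even mu i k : is_uniform_sphere mu ->
  mom mu i (2 * k) = (2 * k)`!%:R * sphere_coef N k.
Proof.
move=> mu_unif; elim: k => [|k ih].
  by rewrite muln0 fact0 mul1r mom0 ?mu_unif.1// /sphere_coef big_ord0.
have N0 : (0 < N)%N := leq_ltn_trans (leq0n i) (ltn_ord i).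
have := mom_rec i k mu_unif; rewrite ih sphere_coefS => h.
have h1 : (2 * k + N)%:R != 0 :> R by rewrite pnatr_eq0 -lt0n addn_gt0 N0 orbT.
apply: (mulfI h1); rewrite h !mulnS !add2n !factS !natrM.
have h2 : k.+1%:R != 0 :> R by rewrite pnatr_eq0.
have h3 : (2 + 2 * k)%:R != 0 :> R by rewrite pnatr_eq0.
by field; move: h1 h3; rewrite natrD natrM => ->; rewrite natrD natrM => ->.
Qed.

Lemma cvg_mgf0 mu i (b : R) : is_uniform_sphere mu ->
  series (fun k => sphere_coef N k * (b ^+ 2) ^+ k) n @[n --> \oo] --> mgfn mu i 0 b.
Proof.
move=> mu_unif.
have := cvg_comp (fun n => 2 * n)%N _ (@cvg_mulnl 2 isT) (@cvg_mgfn mu i 0 b mu_unif.1).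
rewrite [X in X n @[n --> _]](_ : _ = series (fun k => sphere_coef N k * (b ^+ 2) ^+ k))//.
apply/funext => n /=; apply: series_even => k.
  by rewrite add0n mom_odd// mulr0.
rewrite add0n mom_even// -exprM; field.
by rewrite pnatr_eq0 -lt0n fact_gt0.
Qed.

(** Once [b] is taken out, [1 / (2 k + N)] is the quotient of the coefficients of this series and of
    [cvg_mgf0]; its decrease in [k] is what later makes [tilt_mean b / b] decrease. *)
Lemma cvg_mgf1 mu i (b : R) : is_uniform_sphere mu ->
  b * series (fun k => sphere_coef N k / (2 * k + N)%:R * (b ^+ 2) ^+ k) n @[n --> \oo]
  --> mgfn mu i 1 b.
Proof.
move=> mu_unif.
have := cvg_comp (fun n => 2 * n)%N _ (@cvg_mulnl 2 isT) (@cvg_mgfn mu i 1 b mu_unif.1).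
rewrite [X in X n @[n --> _]](_ : _ =
  fun n => b * series (fun k => sphere_coef N k / (2 * k + N)%:R * (b ^+ 2) ^+ k) n)//.
have N0 : (0 < N)%N := leq_ltn_trans (leq0n i) (ltn_ord i).
apply/funext => n /=; rewrite series_scale; apply: series_odd => k.
  by rewrite add1n mom_odd// mulr0.
rewrite (_ : (1 + (2 * k).+1)%N = (2 * k.+1)%N); last by rewrite mulnS.
rewrite mom_even// sphere_coefS -exprM exprS.
rewrite mulnS add2n !factS !natrM.
have h1 : (2 * k + N)%:R != 0 :> R by rewrite pnatr_eq0 -lt0n addn_gt0 N0 orbT.
have h2 : (2 * k).+1%:R != 0 :> R by rewrite pnatr_eq0.
have h3 : (2 * k)`!%:R != 0 :> R by rewrite pnatr_eq0 -lt0n fact_gt0.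
have h4 : 2 + 2 * k%:R != 0 :> R by rewrite -natrM -natrD pnatr_eq0.
field; rewrite h3 h4 /=; move: h1 h2.
by rewrite natrD natrM => ->; rewrite -nat1r natrM => ->.
Qed.
End SphereMGF.

(** * Derivatives and strict log-convexity of the moment generating function *)

Section MGFCalculus.
Context {R : realType} {N : nat} (mu : probability (vec R N) R) (i : 'I_N).
Hypothesis mu_unif : is_uniform_sphere mu.
Local Notation S := (@sphere R N).
Local Notation M e b := (mgfn mu i e b).

Lemma is_derive_mgfn e (b : R) : is_derive b 1 (mgfn mu i e) (M e.+1 b).
Proof.
pose f (b : R) (y : vec R N) := tnth y i ^+ e * expR (b * tnth y i).
have df (c : R) (y : vec R N) :
    is_derive c 1 (f ^~ y) (tnth y i ^+ e.+1 * expR (c * tnth y i)).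
  apply: is_derive_eq; rewrite /GRing.scale/= exprS; ring.
have d1f c y : partial1of2 f c y = tnth y i ^+ e.+1 * expR (c * tnth y i).
  by rewrite partial1of2E; have [_ <-] := df c y.
(* On the window of radius 1 around [b], the exponent is at most [|b| + 1] on the sphere, and powers
   of a coordinate are at most 1. *)
pose C : R := expR (`|b| + 1).
have bb : `](b - 1), (b + 1)[%classic b by rewrite /= in_itv/= gtrBl ltrDl ltr01.
have intf c : `](b - 1), (b + 1)[%classic c -> mu.-integrable S (EFin \o f c).
  by move=> _; exact: integrable_mgfn.
have derf c y : `](b - 1), (b + 1)[%classic c -> S y -> derivable (f ^~ y) c 1.
  by move=> _ _; have [] := df c y.
have intC : mu.-integrable S (EFin \o cst C) by exact: finite_measure_integrable_cst.
have ub c y : `](b - 1), (b + 1)[%classic c -> S y -> `|partial1of2 f c y| <= C.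
  move=> /=; rewrite in_itv/= => /andP[cb1 cb2] Sy; rewrite d1f.
  apply: le_trans (mgfn_bound _ _ _ Sy) _; rewrite ler_expR -lerBlDl.
  apply: le_trans (lerB_dist _ _) _; rewrite ler_norml; apply/andP; split; lra.
have C0 (y : vec R N) : 0 <= cst C y by exact: expR_ge0.
split; first exact: (derivable_under_integral _ bb intf derf C0 intC ub).
rewrite -derive1E (differentiation_under_integral _ bb intf derf C0 intC ub)//.
by apply: eq_Rintegral => y _; rewrite d1f.
Qed.

Lemma mgf00 : M 0 0 = 1.
Proof.
rewrite -(mom0 i mu_unif.1) /mgfn /mom.
by apply: eq_Rintegral => y _; rewrite mul0r expR0 mulr1.
Qed.

Lemma mom2 : N%:R * mom mu i 2 = 1.
Proof. by have := mom_rec i 0 mu_unif; rewrite muln0 add0n muln1 mom0 ?mu_unif.1 ?mulr1. Qed.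

Lemma mom1 : mom mu i 1 = 0.
Proof. by have := mom_odd i 0 mu_unif; rewrite muln0. Qed.

(** The function [g] certifies that [h] is not almost everywhere zero: if the integral of [h]
    vanished, then [h], and with it [g], would be zero almost everywhere. *)
Lemma Rintegral_gt0 (nu : probability (vec R N) R) (h g : vec R N -> R) :
  nu.-integrable S (EFin \o h) -> nu.-integrable S (EFin \o g) ->
  (forall y, S y -> 0 <= h y) -> (forall y, S y -> h y = 0 -> g y = 0) ->
  \int[nu]_(y in S) g y != 0 -> 0 < \int[nu]_(y in S) h y.
Proof.
move=> ih ig h0 hg g0; rewrite lt_neqAle Rintegral_ge0// andbT.
apply: contra g0 => /eqP I0.
have : (\int[nu]_(y in S) `|(EFin \o h) y| = 0)%E.
  rewrite (@eq_integral _ _ _ _ S (EFin \o h)); last first.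
    by move=> y; rewrite inE => Sy; rewrite /= ger0_norm// h0.
  by rewrite -(fineK (integrable_fin_num _ ih))// -[fine _]I0.
move=> /ae_eq_integral_abs => /(_ measurable_sphere (measurable_int _ ih)) ae0.
rewrite /Rintegral (@ae_eq_integral _ _ _ _ S (cst 0%E))// ?integral0//.
  exact: measurable_int ig.
by apply: filterS ae0 => y /= hy Sy; rewrite hg//; have [] := hy Sy.
Qed.

Lemma mgf_gt0 (b : R) : 0 < M 0 b.
Proof.
apply: (@Rintegral_gt0 _ _ (cst 1)).
- exact: integrable_mgfn.
- exact: finite_measure_integrable_cst.
- by move=> y _; rewrite expr0 mul1r expR_ge0.
- by move=> y _ /eqP; rewrite expr0 mul1r gt_eqF// expR_gt0.
- by rewrite Rintegral_cst// mul1r (_ : fine _ = 1) ?oner_eq0//; exact: (congr1 fine mu_unif.1).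
Qed.

Definition tilt_mean (b : R) := M 1 b / M 0 b.

(* Strict Jensen for the tilted law, from [e^u > 1 + u] at [u = (c - b) (y_i - m)]; equality
   would force [y_i = m] almost surely, against [E y_i = 0] and [N E y_i^2 = 1]. *)
Lemma mgf_gt_tangent (b c : R) : c != b ->
  M 0 b * expR (tilt_mean b * (c - b)) < M 0 c.
Proof.
move=> cb; pose m := tilt_mean b; pose u (y : vec R N) := (c - b) * (tnth y i - m).
pose h y := expR (b * tnth y i) * (expR (u y) - 1 - u y).
have hE y : h y = expR (- m * (c - b)) * (tnth y i ^+ 0 * expR (c * tnth y i)) -
    (1 - (c - b) * m) * (tnth y i ^+ 0 * expR (b * tnth y i)) -
    (c - b) * (tnth y i ^+ 1 * expR (b * tnth y i)).
  have -> : expR (c * tnth y i) = expR (b * tnth y i) * expR (u y) * expR (m * (c - b)).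
    by rewrite -!expRD /u; congr expR; ring.
  have : expR (- m * (c - b)) * expR (m * (c - b)) = 1.
    by rewrite -expRD mulNr addNr expR0.
  rewrite /h /u; set e1 := expR (- m * _); set e2 := expR (m * _) => e12.
  rewrite expr0 expr1 !mul1r [e1 * _]mulrC -!mulrA [e2 * e1]mulrC e12; ring.
have ic0 e a : mu.-integrable S (EFin \o (fun y : vec R N => tnth y i ^+ e * expR (a * tnth y i))).
  exact: integrable_mgfn.
pose k1 := expR (- m * (c - b)); pose k2 := 1 - (c - b) * m.
have i1 := integrable_RZl k1 (ic0 0%N c).
have i2 := integrable_RZl k2 (ic0 0%N b).
have i3 := integrable_RZl (c - b) (ic0 1%N b).
have i12 := integrable_RB i1 i2.
have ih : mu.-integrable S (EFin \o h).
  by apply: eq_integrable (integrable_RB i12 i3) => // y _; rewrite /= hE.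
have hI : \int[mu]_(y in S) h y = expR (- m * (c - b)) * M 0 c - M 0 b.
  under eq_Rintegral do rewrite hE.
  rewrite (RintegralB measurable_sphere i12 i3) (RintegralB measurable_sphere i1 i2).
  rewrite (RintegralZl k1 measurable_sphere (ic0 0%N c)).
  rewrite (RintegralZl k2 measurable_sphere (ic0 0%N b)).
  rewrite (RintegralZl (c - b) measurable_sphere (ic0 1%N b)) -/(M 0 c) -/(M 0 b) -/(M 1 b).
  have aux (k M0b M0c M1b : R) : M0b != 0 ->
      k * M0c - (1 - (c - b) * (M1b / M0b)) * M0b - (c - b) * M1b = k * M0c - M0b.
    by move=> M0b_neq0; field.
  by apply: aux; rewrite gt_eqF// mgf_gt0.
have jm : mu.-integrable S (EFin \o (fun y : vec R N => tnth y i ^+ 1)).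
  by apply: (@integrable_sphere R N _ _ 1); [exact: measurable_coordX|exact: sphere_coordX_le1].
have jm2 : mu.-integrable S (EFin \o (fun y : vec R N => tnth y i ^+ 2)).
  by apply: (@integrable_sphere R N _ _ 1); [exact: measurable_coordX|exact: sphere_coordX_le1].
have jc : mu.-integrable S (EFin \o cst (- m ^+ 2)) by exact: finite_measure_integrable_cst.
have j1 := integrable_RZl (2 * m) jm.
have j12 := integrable_RB jm2 j1.
have sqE (y : vec R N) : (tnth y i - m) ^+ 2 =
    tnth y i ^+ 2 - (2 * m) * tnth y i ^+ 1 - cst (- m ^+ 2) y.
  by rewrite /=; ring.
have : 0 < \int[mu]_(y in S) h y.
  apply: (@Rintegral_gt0 _ _ (fun y => (tnth y i - m) ^+ 2)) => //.
  - by apply: eq_integrable (integrable_RB j12 jc) => // y _; rewrite /= sqE.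
  - by move=> y _; rewrite mulr_ge0 ?expR_ge0// subr_ge0 lerBrDl expR_ge1Dx.
  - move=> y _ /eqP; rewrite mulf_eq0 gt_eqF ?expR_gt0//= => hy.
    have /eqP : u y == 0.
      apply: contraTT hy => uy; rewrite gt_eqF// subr_gt0 ltrBrDl.
      exact: expR_gt1Dx.
    by move/eqP; rewrite mulf_eq0 !subr_eq0 (negbTE cb)/= => /eqP ->; rewrite subrr expr0n.
  - under eq_Rintegral do rewrite sqE.
    rewrite !RintegralB// RintegralZl// Rintegral_cst// -/(mom mu i 1) -/(mom mu i 2).
    rewrite mom1 mulr0 subr0 (_ : fine _ = 1); last exact: (congr1 fine mu_unif.1).
    rewrite mulr1 opprK gt_eqF// ltr_wpDr ?sqr_ge0//.
    have N0 : (0 : R) < N%:R by rewrite ltr0n (leq_ltn_trans (leq0n i) (ltn_ord i)).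
    by rewrite -(pmulr_rgt0 _ N0) mom2.
rewrite hI subr_gt0 mulNr expRN mulrC ltr_pdivlMr ?expR_gt0//.
Qed.
End MGFCalculus.

(** * Monotonicity of the tilted mean *)

Section SeriesRatio.
Context {R : realType}.
Variables (a r : R^nat) (x y : R).
Hypotheses (a_gt0 : forall k, 0 < a k) (r_decr : forall k, r k.+1 < r k)
  (x_ge0 : 0 <= x) (xy : x < y).
Let A (z : R) := series (fun k => a k * z ^+ k).
Let D (z : R) := series (fun k => a k * r k * z ^+ k).

Let r_le j k : (j <= k)%N -> r k <= r j.
Proof. by apply: (@nonincreasing_seqP _ _ r).1 => n; exact: ltW. Qed.

(** The increment at [n] is a sum over [k < n] of positive weights times
    [(r k - r n) (x^k y^n - x^n y^k)], where both brackets are nonnegative. *)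
Lemma cross_series_nondecreasing :
  nondecreasing_seq (fun n => D x n * A y n - D y n * A x n).
Proof.
apply/nondecreasing_seqP => n; rewrite -subr_ge0.
rewrite [X in 0 <= X](_ : _ = \sum_(0 <= k < n)
    a n * a k * (r k - r n) * (x ^+ k * y ^+ n - x ^+ n * y ^+ k)); last first.
  rewrite [RHS](eq_bigr (fun k => (a n * y ^+ n) * (a k * r k * x ^+ k)
    - (a n * x ^+ n) * (a k * r k * y ^+ k)
    + ((a n * r n * x ^+ n) * (a k * y ^+ k) - (a n * r n * y ^+ n) * (a k * x ^+ k))));
    last by move=> k _; ring.
  rewrite big_split/= !sumrB -!mulr_sumr /A /D /series /= !big_nat_recr//=; ring.
rewrite big_nat_cond; apply: sumr_ge0 => k /andP[/andP[_ kn] _].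
have y0 : 0 <= y by rewrite (le_trans x_ge0)// ltW.
apply: mulr_ge0.
  by rewrite mulr_ge0 ?subr_ge0 ?r_le ?(ltnW kn)// mulr_ge0 ?ltW.
rewrite -(subnKC (ltnW kn)) !exprD.
rewrite [X in 0 <= X](_ : _ = x ^+ k * y ^+ k * (y ^+ (n - k) - x ^+ (n - k))); last by ring.
by rewrite !mulr_ge0 ?exprn_ge0// subr_ge0 lerXn2r ?nnegrE// ltW.
Qed.

Lemma series_ratio_lt (lAx lAy lDx lDy : R) :
  A x n @[n --> \oo] --> lAx -> A y n @[n --> \oo] --> lAy ->
  D x n @[n --> \oo] --> lDx -> D y n @[n --> \oo] --> lDy ->
  lDy * lAx < lDx * lAy.
Proof.
move=> cAx cAy cDx cDy; rewrite -subr_gt0.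
have c : D x n * A y n - D y n * A x n @[n --> \oo] --> lDx * lAy - lDy * lAx.
  by apply: cvgB; exact: cvgM.
(* The limit alone would give a weak inequality. The two-term partial sums are the first with a
   positive difference, and the differences do not decrease. *)
apply: (@lt_le_trans _ _ (D x 2%N * A y 2%N - D y 2%N * A x 2%N)).
  rewrite /A /D /series /= !big_nat_recr//= !big_geq//.
  rewrite [ltRHS](_ : _ = a 0%N * a 1%N * (r 0%N - r 1%N) * (y - x)); last by ring.
  by rewrite !mulr_gt0 ?subr_gt0//.
apply: (cvgr_to_ge c); exists 2%N => // n /= n2.
exact: cross_series_nondecreasing.
Qed.
End SeriesRatio.

Section TiltMean.
Context {R : realType} {N : nat} (mu : probability (vec R N) R) (i : 'I_N).
Hypothesis mu_unif : is_uniform_sphere mu.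
Local Notation S := (@sphere R N).
Local Notation M e b := (mgfn mu i e b).
Local Notation m := (tilt_mean mu i).

Let N_gt0 : (0 < N)%N.
Proof. exact: leq_ltn_trans (leq0n i) (ltn_ord i). Qed.

Lemma sphere_coef_gt0 k : 0 < sphere_coef N k :> R.
Proof.
rewrite /sphere_coef prodr_gt0// => j _.
by rewrite invr_gt0 ltr0n muln_gt0 /= addn_gt0 N_gt0 orbT.
Qed.

Lemma ratio_coef_decr k : ((2 * k.+1 + N)%:R^-1 < (2 * k + N)%:R^-1 :> R).
Proof.
by rewrite ltf_pV2 ?posrE ?ltr0n ?addn_gt0 ?N_gt0 ?orbT// ltr_nat; lia.
Qed.

Lemma cvg_mgf1_div (b : R) : 0 < b ->
  series (fun k => sphere_coef N k * (2 * k + N)%:R^-1 * (b ^+ 2) ^+ k) n @[n --> \oo]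
  --> M 1 b / b.
Proof.
move=> b0; have h := cvgM (@cvg_mgf1 _ _ mu i b mu_unif) (cvg_cst b^-1).
set s := series _; suff <- : (fun n => b * s n * b^-1) = s by exact: h.
by apply/funext => n /=; rewrite mulrAC divff ?mul1r// gt_eqF.
Qed.

Lemma mgf_ratio_lt (x y : R) : 0 < x -> x < y ->
  M 1 y / y * M 0 x < M 1 x / x * M 0 y.
Proof.
move=> x0 xy; have y0 := lt_trans x0 xy.
apply: (series_ratio_lt (a := sphere_coef N) (r := fun k => (2 * k + N)%:R^-1)
  (x := x ^+ 2) (y := y ^+ 2)).
- exact: sphere_coef_gt0.
- exact: ratio_coef_decr.
- exact: sqr_ge0.
- by rewrite ltrXn2r ?nnegrE// ltW.
- exact: cvg_mgf0.
- exact: cvg_mgf0.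
- exact: cvg_mgf1_div.
- exact: cvg_mgf1_div.
Qed.

Lemma series_at0 (a : R^nat) : series (fun k => a k * 0 ^+ k) n @[n --> \oo] --> a 0%N.
Proof.
rewrite -cvg_shiftS /=; set s := series _.
suff -> : (fun n => s n.+1) = fun=> a 0%N by exact: cvg_cst.
apply/funext => n; rewrite /s /series /= big_nat_recl//= expr0 mulr1 big1 ?addr0//.
by move=> k _; rewrite expr0n mulr0.
Qed.

(** The comparison of series once more, with 0 as the smaller point, where the two series take the
    values 1 and [1 / N]. *)
Lemma mgf_ratio_ltN (b : R) : 0 < b -> M 1 b / b < M 0 b / N%:R.
Proof.
move=> b0; rewrite -[ltLHS]mulr1 [ltRHS]mulrC.
apply: (series_ratio_lt (a := sphere_coef N) (r := fun k => (2 * k + N)%:R^-1)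
  (x := 0) (y := b ^+ 2)) => //.
- exact: sphere_coef_gt0.
- exact: ratio_coef_decr.
- by rewrite exprn_gt0.
- have := @series_at0 (sphere_coef N).
  by rewrite {2}/sphere_coef big_ord0.
- exact: cvg_mgf0.
- have := @series_at0 (fun k => sphere_coef N k * (2 * k + N)%:R^-1).
  by rewrite {2}/sphere_coef big_ord0 mul1r.
- exact: cvg_mgf1_div.
Qed.

(** All terms of the series are nonnegative, and the bound keeps the first. It yields the positivity
    of the tilted mean and, in [critical_ex], a point where that mean is at least [b / beta]. *)
Lemma mgf1_ge (b : R) : 0 < b -> b / N%:R <= M 1 b.
Proof.
move=> b0; rewrite mulrC -ler_pdivlMr//.
apply: (cvgr_to_ge (cvg_mgf1_div b0)); exists 1%N => // n /= n1.
apply: (@le_trans _ _ (series (fun k => sphere_coef N k * (2 * k + N)%:R^-1 * (b ^+ 2) ^+ k) 1%N)).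
  by rewrite /series /= big_nat1 /sphere_coef big_ord0 mul1r expr0 mulr1.
rewrite -subr_ge0 sub_series_geq//; apply: sumr_ge0 => k _.
by rewrite !mulr_ge0 ?invr_ge0 ?exprn_ge0 ?(ltW b0) ?(ltW (sphere_coef_gt0 k)).
Qed.

Lemma tilt_mean0 : m 0 = 0.
Proof.
have -> : m 0 = mom mu i 1 / M 0 0; last by rewrite mom1// mul0r.
congr (_ / _).
by apply: eq_Rintegral => y _; rewrite mul0r expR0 mulr1.
Qed.

Lemma tilt_mean_gt0 (b : R) : 0 < b -> 0 < m b.
Proof.
move=> b0; rewrite divr_gt0 ?mgf_gt0//.
by rewrite (lt_le_trans _ (mgf1_ge b0))// divr_gt0// ltr0n.
Qed.

Lemma tilt_mean_ge0 (b : R) : 0 <= b -> 0 <= m b.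
Proof.
by rewrite le_eqVlt => /predU1P[<-|/tilt_mean_gt0/ltW//]; rewrite tilt_mean0.
Qed.

Lemma tilt_mean_le1 (b : R) : m b <= 1.
Proof.
rewrite ler_pdivrMr ?mgf_gt0// mul1r; apply: (le_Rintegral measurable_sphere).
- exact: (integrable_mgfn mu i 1 b).
- exact: (integrable_mgfn mu i 0 b).
- move=> y Sy; rewrite ler_wpM2r ?expR_ge0// expr0 expr1.
  by have := sphere_coord_le1 i Sy; rewrite ler_norml => /andP[].
Qed.

Lemma tilt_mean_ratio_decr (x y : R) : 0 < x -> x < y -> m y / y < m x / x.
Proof.
move=> x0 xy; rewrite /tilt_mean.
have Mx := mgf_gt0 i mu_unif x; have My := mgf_gt0 i mu_unif y.
rewrite -(ltr_pM2r Mx) -(ltr_pM2r My).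
have aux (k M0x M0y M1x : R) : M0x != 0 ->
    M1x / M0x / k * M0x * M0y = M1x / k * M0y by move=> ?; rewrite [_ / k]mulrAC divfK.
rewrite [ltRHS]aux ?gt_eqF// [ltLHS]mulrAC [ltLHS]aux ?gt_eqF//.
exact: mgf_ratio_lt.
Qed.

Lemma tilt_mean_ltN (b : R) : 0 < b -> m b < b / N%:R.
Proof.
move=> b0; rewrite ltr_pdivrMr ?mgf_gt0//; have := mgf_ratio_ltN b0.
rewrite ltr_pdivrMr//; suff -> : M 0 b / N%:R * b = b / N%:R * M 0 b by [].
ring.
Qed.

Lemma is_derive_ln_mgf (b : R) : is_derive b 1 (fun b => ln (M 0 b)) (m b).
Proof.
have d := is_derive_mgfn mu i 0 b.
have dl := is_derive1_ln (mgf_gt0 i mu_unif b).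
have := is_derive1_comp dl d; rewrite /tilt_mean mulrC.
exact.
Qed.

Lemma continuous_mgfn e : continuous (mgfn mu i e).
Proof.
move=> b; apply/differentiable_continuous/derivable1_diffP.
by have [] := is_derive_mgfn mu i e b.
Qed.

Lemma continuous_tilt_mean : continuous m.
Proof.
move=> b; apply: cvgM; first exact: continuous_mgfn.
by apply: cvgV; [rewrite gt_eqF// mgf_gt0|exact: continuous_mgfn].
Qed.

End TiltMean.

(** * Bessel functions *)

Section BesselMGF.
Context {R : realType} {N : nat} (mu : probability (vec R N) R) (i : 'I_N).
Hypothesis mu_unif : is_uniform_sphere mu.
Local Notation M e b := (mgfn mu i e b).
Local Notation m := (tilt_mean mu i).

Let N_gt0 : (0 < N)%N.
Proof. exact: leq_ltn_trans (leq0n i) (ltn_ord i). Qed.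

Let half_gt0 k : 0 < k%:R + N%:R / 2 :> R.
Proof. by rewrite ltr_wpDl// divr_gt0// ltr0n. Qed.

(** Telescoping of [Gamma (s + 1) = s * Gamma s], as [2 k + N = 2 (k + N / 2)]. The factor [4 ^ k]
    is the one in [(b / 2) ^ (2 k)] of the Bessel series. *)
Lemma sphere_coefE k : sphere_coef N k =
  Gamma (N%:R / 2) / (4 ^+ k * k`!%:R * Gamma (k%:R + N%:R / 2)) :> R.
Proof.
have G0 k' : Gamma (k'%:R + N%:R / 2) != 0 :> R by rewrite gt_eqF// Gamma_gt0.
elim: k => [|k ih].
  have := G0 0%N; rewrite add0r /sphere_coef big_ord0 expr0 fact0 !mul1r => h.
  by rewrite divff.
have -> : k.+1%:R + N%:R / 2 = k%:R + N%:R / 2 + 1 :> R by rewrite -natr1 addrAC.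
rewrite sphere_coefS ih GammaD1// exprS factS.
have h1 : k`!%:R != 0 :> R by rewrite pnatr_eq0 -lt0n fact_gt0.
have h2 : k.+1%:R != 0 :> R by rewrite pnatr_eq0.
have h3 : (2 * k + N)%:R != 0 :> R by rewrite pnatr_eq0 -lt0n addn_gt0 N_gt0 orbT.
have h4 : k%:R + N%:R / 2 = (2 * k + N)%:R / 2 :> R by rewrite natrD natrM; field.
have h5 := G0 k.
set G := Gamma (k%:R + _) in h5 *.
rewrite !natrM h4; field.
by rewrite h5 h1 nat1r h2 expf_neq0//; move: h3; rewrite natrD natrM => ->.
Qed.

Lemma besselI_mgf0 (b : R) : 0 < b ->
  besselI (N%:R / 2 - 1) b = powR (b / 2) (N%:R / 2 - 1) / Gamma (N%:R / 2) * M 0 b.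
Proof.
move=> b0; rewrite /besselI; apply: cvg_lim => //.
have h := cvgM (cvg_cst (powR (b / 2) (N%:R / 2 - 1) / Gamma (N%:R / 2)))
  (@cvg_mgf0 _ _ mu i b mu_unif).
set s := series _; suff -> : s = (fun n => powR (b / 2) (N%:R / 2 - 1) / Gamma (N%:R / 2) *
  series (fun k => sphere_coef N k * (b ^+ 2) ^+ k) n) by exact: h.
apply/funext => n; rewrite /s series_scale; congr series; apply/funext => k.
rewrite sphere_coefE [k%:R + (_ - 1)]addrA subrK powRD; last first.
  by apply/implyP => _; rewrite gt_eqF// divr_gt0.
rewrite powR_mulrn ?divr_ge0 ?ltW// expr_div_n exprM !(exprM _ 2 k).
have h0 : Gamma (N%:R / 2) != 0 :> R by rewrite gt_eqF// Gamma_gt0// divr_gt0// ltr0n.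
have h1 : k`!%:R != 0 :> R by rewrite pnatr_eq0 -lt0n fact_gt0.
have h5 : Gamma (k%:R + N%:R / 2) != 0 :> R by rewrite gt_eqF// Gamma_gt0.
rewrite (_ : 2 ^+ 2 = 4 :> R); last by rewrite -natrX.
have aux (B f P F G0 Gk : R) : f != 0 -> F != 0 -> G0 != 0 -> Gk != 0 ->
    B / f * P / (F * Gk) = P / G0 * (G0 / (f * F * Gk) * B).
  by move=> *; field; apply/and4P.
by apply: aux => //; rewrite expf_neq0.
Qed.

(** Raising the order by one brings a factor [b / 2] and, through [GammaD1], a divisor [k + N / 2];
    together they make [b / (2 k + N)], so the prefactor is still that of [besselI_mgf0]. *)
Lemma besselI_mgf1 (b : R) : 0 < b ->
  besselI (N%:R / 2) b = powR (b / 2) (N%:R / 2 - 1) / Gamma (N%:R / 2) * M 1 b.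
Proof.
move=> b0; rewrite /besselI; apply: cvg_lim => //.
have h := cvgM (cvg_cst (powR (b / 2) (N%:R / 2 - 1) / Gamma (N%:R / 2)))
  (@cvg_mgf1 _ _ mu i b mu_unif).
set s := series _; suff -> : s = (fun n => powR (b / 2) (N%:R / 2 - 1) / Gamma (N%:R / 2) *
  (b * series (fun k => sphere_coef N k / (2 * k + N)%:R * (b ^+ 2) ^+ k) n)) by exact: h.
apply/funext => n; rewrite /s !series_scale; congr series; apply/funext => k.
have b2 : b / 2 != 0 by rewrite gt_eqF// divr_gt0.
rewrite sphere_coefE GammaD1// -{1}(subrK 1 (N%:R / 2)) addrA powRD ?b2 ?implybT//.
rewrite powRD ?b2 ?implybT// powRr1 ?divr_ge0 ?ltW//.
rewrite powR_mulrn ?divr_ge0 ?ltW// expr_div_n exprM !(exprM _ 2 k).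
have h0 : Gamma (N%:R / 2) != 0 :> R by rewrite gt_eqF// Gamma_gt0// divr_gt0// ltr0n.
have h1 : k`!%:R != 0 :> R by rewrite pnatr_eq0 -lt0n fact_gt0.
have h5 : Gamma (k%:R + N%:R / 2) != 0 :> R by rewrite gt_eqF// Gamma_gt0.
have h3 : (2 * k + N)%:R != 0 :> R by rewrite pnatr_eq0 -lt0n addn_gt0 N_gt0 orbT.
rewrite (_ : 2 ^+ 2 = 4 :> R); last by rewrite -natrX.
have h4 : k%:R + N%:R / 2 = (2 * k + N)%:R / 2 :> R by rewrite natrD natrM; field.
set G := Gamma (k%:R + _) in h5 *.
rewrite h4.
have aux (B f P F G0 Gk q : R) : f != 0 -> F != 0 -> G0 != 0 -> Gk != 0 -> q != 0 ->
    B / f * P * (b / 2) / (F * (q / 2 * Gk)) = P / G0 * (b * (G0 / (f * F * Gk) / q * B)).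
  by move=> *; field; apply/and5P.
by apply: aux => //; rewrite expf_neq0.
Qed.

Lemma ratioI_tilt_mean (b : R) : 0 < b -> ratioI N b = m b.
Proof.
move=> b0; rewrite /ratioI besselI_mgf1// besselI_mgf0// /tilt_mean.
have h0 : 0 < Gamma (N%:R / 2) :> R by rewrite Gamma_gt0// divr_gt0// ltr0n.
have h1 : 0 < powR (b / 2) (N%:R / 2 - 1) by rewrite powR_gt0// divr_gt0.
have h2 := mgf_gt0 i mu_unif b.
by field; rewrite !gt_eqF.
Qed.

Lemma B_gt0 n : 0 < B_ R n.
Proof.
rewrite /B_; case: ifP => _.
  by rewrite mulr_gt0 ?exprn_gt0// /pochhammer prodr_gt0// => j _; rewrite ltr_pwDl.
(* Each [2 k - 1] is odd, so no factor vanishes. *)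
rewrite prodr_gt0// => j _; rewrite normr_gt0 subr_eq0 -natrM pnatr_eq1.
by apply/eqP => h; have := congr1 odd h; rewrite mul2n odd_double.
Qed.

Lemma A_gt0 n : (0 < n)%N -> 0 < A_ R n.
Proof.
move=> n0; rewrite /A_ divr_gt0 ?mulr_gt0 ?powR_gt0 ?pi_gt0//.
by rewrite Gamma_gt0// divr_gt0// ltr0n.
Qed.

(** The first two terms are the relative entropy of the tilted law with parameter [b], and [m b] is
    the component of its mean along the axis: this is the meaning of [Phi]. *)
Definition tilt_free_energy (beta b : R) := b * m b - ln (M 0 b) - beta / 2 * m b ^+ 2.

Local Notation phi := tilt_free_energy.

(** What accompanies [1 / M 0 b] in the logarithm of [Phi] once the powers of [b] cancel. Only its
    positivity matters. *)
Definition Phi_const : R := A_ R N / A_ R N.-1 / (B_ R N * pi)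
  * powR 2 (N%:R / 2 - 1) * Gamma (N%:R / 2).

Hypothesis N_ge2 : (2 <= N)%N.

Let N1_gt0 : (0 < N.-1)%N.
Proof. by rewrite -subn1 subn_gt0. Qed.

Lemma Phi_const_gt0 : 0 < Phi_const.
Proof.
have h6 : 0 < Gamma (N%:R / 2) :> R by rewrite Gamma_gt0// divr_gt0// ltr0n.
have h1 := A_gt0 N_gt0; have h2 := A_gt0 N1_gt0; have h3 := B_gt0 N.
rewrite /Phi_const; move: (A_ R N) (A_ R N.-1) (B_ R N) h1 h2 h3 => a1 a2 a3 h1 h2 h3.
by rewrite !mulr_gt0 ?invr_gt0 ?mulr_gt0 ?pi_gt0 ?powR_gt0.
Qed.

Lemma Phi_tilt_free_energy (beta b : R) : 0 < b -> Phi N beta b = phi beta b + ln Phi_const.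
Proof.
move=> b0; rewrite /Phi ratioI_tilt_mean// /phi.
have M0 := mgf_gt0 i mu_unif b.
have -> : A_ R N / A_ R N.-1 * powR b (N%:R / 2 - 1)
        / (B_ R N * pi * besselI (N%:R / 2 - 1) b) = Phi_const / M 0 b.
  have h7 : powR 2^-1 (N%:R / 2 - 1) = (powR 2 (N%:R / 2 - 1))^-1 :> R.
    have p0 : powR 2 (N%:R / 2 - 1) != 0 :> R by rewrite gt_eqF// powR_gt0.
    by apply: (mulIf p0); rewrite mulVf// -powRM ?invr_ge0// mulVf// powR1.
  rewrite besselI_mgf0// powRM ?invr_ge0 ?ltW// h7.
  have h1 : 0 < A_ R N.-1 by rewrite A_gt0.
  have h2 := B_gt0 N.
  have h3 := @pi_gt0 R.
  have h4 : 0 < powR 2 (N%:R / 2 - 1) :> R by rewrite powR_gt0.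
  have h5 : 0 < powR b (N%:R / 2 - 1) by rewrite powR_gt0.
  have h6 : 0 < Gamma (N%:R / 2) :> R by rewrite Gamma_gt0// divr_gt0// ltr0n.
  have aux (a a1 c q tp bp G z : R) : 0 < a1 -> 0 < c -> 0 < q -> 0 < tp -> 0 < bp ->
      0 < G -> 0 < z ->
      a / a1 * bp / (c * q * (bp / tp / G * z)) = a / a1 / (c * q) * tp * G / z.
    by move=> *; field; rewrite !gt_eqF.
  exact: aux.
rewrite ln_div ?posrE ?Phi_const_gt0//; ring.
Qed.

Lemma continuous_tilt_free_energy beta : continuous (phi beta).
Proof.
move=> b; apply: cvgB; [apply: cvgB|].
- by apply: cvgM; [exact: cvg_id|exact: continuous_tilt_mean].
- have [+ _] := is_derive_ln_mgf i mu_unif b.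
  by move=> /derivable1_diffP /differentiable_continuous.
- apply: cvgM; first exact: cvg_cst.
  by under eq_fun do rewrite expr2; apply: cvgM; exact: continuous_tilt_mean.
Qed.

(** The Bessel identities are stated for [b > 0], so the value at 0 is reached through the
    continuity of [phi]. *)
Lemma cvg_Phi_at0 beta : Phi N beta x @[x --> 0^'+] --> phi beta 0 + ln Phi_const.
Proof.
have h : phi beta x + ln Phi_const @[x --> 0^'+] --> phi beta 0 + ln Phi_const.
  apply: cvg_at_right_filter; apply: cvgD; last exact: cvg_cst.
  exact: continuous_tilt_free_energy.
apply: cvg_trans h; apply: near_eq_cvg; near=> x; rewrite Phi_tilt_free_energy//.
Unshelve. all: by end_near. Qed.

Lemma PhiExt_tilt_free_energy beta b : 0 <= b -> PhiExt N beta b = phi beta b + ln Phi_const.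
Proof.
rewrite le_eqVlt /PhiExt => /predU1P[<-|b0].
  by rewrite eqxx; apply: cvg_lim => //; exact: cvg_Phi_at0.
by rewrite gt_eqF// Phi_tilt_free_energy.
Qed.
End BesselMGF.

(** * Minimization of the reduced energy *)

Lemma continuous_root {R : realType} (g : R -> R) (a b : R) : a <= b -> continuous g ->
  g a <= 0 -> 0 <= g b -> exists2 c, a <= c <= b & g c = 0.
Proof.
move=> ab cg ga gb; have [||c cab gc] := @IVT R g a b 0 ab.
- exact: continuous_subspaceT.
- by rewrite ge_min ga le_max gb orbT.
- by exists c => //; move: cab; rewrite in_itv.
Qed.

Section Minimization.
Context {R : realType} {N : nat} (mu : probability (vec R N) R) (i : 'I_N).
Hypothesis mu_unif : is_uniform_sphere mu.
Local Notation M e b := (mgfn mu i e b).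
Local Notation m := (tilt_mean mu i).
Local Notation phi := (tilt_free_energy mu i).

Let N_gt0 : (0 : R) < N%:R.
Proof. by rewrite ltr0n (leq_ltn_trans (leq0n i) (ltn_ord i)). Qed.

Lemma ln_mgf_gt_tangent (b c : R) : c != b ->
  ln (M 0 b) + m b * (c - b) < ln (M 0 c).
Proof.
move=> cb; rewrite -[X in _ + X]expRK -lnM ?posrE ?expR_gt0 ?mgf_gt0//.
by rewrite ltr_ln ?posrE ?mulr_gt0 ?expR_gt0 ?mgf_gt0// mgf_gt_tangent.
Qed.

Definition reduced_energy (beta r : R) := beta / 2 * r ^+ 2 - ln (M 0 (beta * r)).
Local Notation K := reduced_energy.

(** The strict tangent inequality at [b], read at [beta * m b]. Strictness away from the critical
    points carries the uniqueness of the minimizer over from [K] to [phi]. *)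
Lemma reduced_energy_lt_phi beta b : beta * m b != b -> K beta (m b) < phi beta b.
Proof.
have aux (l1 l2 t : R) : l1 + t * (beta * t - b) < l2 ->
  beta / 2 * t ^+ 2 - l2 < b * t - l1 - beta / 2 * t ^+ 2 by lra.
by move=> /ln_mgf_gt_tangent; exact: aux.
Qed.

Lemma reduced_energyE beta b : b = beta * m b -> K beta (m b) = phi beta b.
Proof.
move=> bE; rewrite /K /tilt_free_energy -bE.
have -> : b * m b = beta * m b ^+ 2 by rewrite expr2 mulrA -bE.
by field.
Qed.

Lemma reduced_energy_le_phi beta b : K beta (m b) <= phi beta b.
Proof.
by have [/esym/reduced_energyE->|/reduced_energy_lt_phi/ltW//] := eqVneq (beta * m b) b.
Qed.

Lemma critical_ratio beta b : 0 < b -> b = beta * m b -> m b / b = beta^-1.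
Proof.
move=> b0 bE; have m0 : m b != 0 by rewrite gt_eqF// tilt_mean_gt0.
have be0 : beta != 0 by apply: contraTneq b0 => z; rewrite bE z mul0r ltxx.
by rewrite {2}bE; field; rewrite be0 m0.
Qed.

Lemma critical_uniq beta b b' : 0 < b -> b = beta * m b -> 0 < b' -> b' = beta * m b' ->
  b' = b.
Proof.
move=> b0 bE b'0 b'E; have := critical_ratio b'0 b'E; rewrite -(critical_ratio b0 bE).
have [bb'|b'b|//] := ltgtP b b'.
- by move=> /eqP; rewrite lt_eqF// tilt_mean_ratio_decr.
- by move=> /eqP; rewrite gt_eqF// tilt_mean_ratio_decr.
Qed.

Lemma critical_ex beta : N%:R < beta -> exists b, 0 < b /\ b = beta * m b.
Proof.
move=> Nb; have be0 : 0 < beta := lt_trans N_gt0 Nb.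
(* Since [b = 0] already solves the equation, the interval for the intermediate value theorem starts
   at a positive [b0]. There [mgf1_ge] gives [m b0 >= b0 / (N * M 0 b0)], which exceeds [b0 / beta]
   because [M 0 b0] is close to 1 and [beta > N]. *)
have [b0 [b00 b0b M0b]] : exists b0, [/\ 0 < b0, b0 <= beta & M 0 b0 < beta / N%:R].
  have c : M 0 x @[x --> 0^'+] --> M 0 0.
    by apply: cvg_at_right_filter; exact: continuous_mgfn.
  have h : M 0 0 < beta / N%:R by rewrite mgf00// ltr_pdivlMr// mul1r.
  near (0 : R)^'+ => x; exists x; split; near: x.
  - exact: nbhs_right_gt.
  - exact: nbhs_right_le.
  - exact: (cvgr_lt _ c).
pose g b := b - beta * m b.
have cg : continuous g.
  move=> b; apply: cvgB; first exact: cvg_id.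
  by apply: cvgM; [exact: cvg_cst|exact: continuous_tilt_mean].
have g1 : g b0 <= 0.
  rewrite subr_le0 -ler_pdivrMl// mulrC.
  rewrite ler_pdivlMr ?mgf_gt0//.
  apply: le_trans (mgf1_ge i mu_unif b00).
  rewrite ler_pdivlMr// (_ : _ * _ = b0 * (M 0 b0 * N%:R / beta)); last by ring.
  by rewrite ler_piMr ?(ltW b00)// ler_pdivrMr// mul1r -ler_pdivlMr// ltW.
have g2 : 0 <= g beta.
  by rewrite subr_ge0 ler_piMr ?(ltW be0)// tilt_mean_le1.
have [b /andP[b0b' _] /eqP] := continuous_root b0b cg g1 g2.
rewrite subr_eq0 => /eqP bE; exists b; split => //.
exact: lt_le_trans b0b'.
Unshelve. all: by end_near. Qed.

(* In the variable [b = beta r] the derivative of the reduced energy is [b / beta - m b]. *)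
Lemma reduced_energy_min_gen (beta bs : R) : 0 < beta -> 0 <= bs ->
  (forall b : R, 0 < b -> b < bs -> b / beta < m b) ->
  (forall b, bs < b -> m b < b / beta) ->
  forall b, 0 <= b -> b != bs ->
  bs ^+ 2 / (2 * beta) - ln (M 0 bs) < b ^+ 2 / (2 * beta) - ln (M 0 b).
Proof.
move=> be0 bs0 lo hi b b0 bbs.
pose L (b : R) : R := b ^+ 2 / (2 * beta) - ln (M 0 b).
have dL (x : R) : is_derive x 1 L (x / beta - m x).
  have d := is_derive_ln_mgf i mu_unif x.
  apply: is_derive_eq; rewrite /GRing.scale/=; field.
  by rewrite gt_eqF.
have cL x y : {within `[x, y], continuous L}.
  apply: derivable_within_continuous => z _.
  by have [] := dL z.
rewrite -/(L bs) -/(L b).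
have [bb|bb|/eqP] := ltgtP b bs; last by rewrite (negbTE bbs).
- have [c + LE] := @MVT _ L _ _ _ bb (fun x _ => dL x) (cL _ _).
  rewrite in_itv/= => /andP[bc cbs].
  rewrite -subr_lt0 LE pmulr_llt0 ?subr_gt0// subr_lt0.
  by apply: lo => //; exact: le_lt_trans bc.
- have [c + LE] := @MVT _ L _ _ _ bb (fun x _ => dL x) (cL _ _).
  rewrite in_itv/= => /andP[bc cbs].
  by rewrite -subr_gt0 LE pmulr_lgt0 ?subr_gt0// hi.
Qed.

(** The equality case determines [beta * r], the tilt parameter in Gibbs' inequality, and not [r]:
    for [beta = 0] the reduced energy is constant and leaves [r] free. *)
Lemma reduced_energy_min (beta bs r : R) : 0 <= beta -> 0 <= r ->
  (beta <= N%:R /\ bs = 0) \/ (0 < bs /\ bs = beta * m bs) ->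
  K beta (m bs) <= K beta r /\ (K beta r <= K beta (m bs) -> beta * r = bs).
Proof.
move=> be0 r0 H.
have bsE : bs = beta * m bs.
  by case: H => [[_ ->]|[]//]; rewrite tilt_mean0// mulr0.
have [beta0|betaN0] := eqVneq beta 0.
  by rewrite /K beta0 !mul0r; split => // _; rewrite bsE beta0 mul0r.
have bep : 0 < beta by rewrite lt_def betaN0.
have KE s : K beta s = (beta * s) ^+ 2 / (2 * beta) - ln (M 0 (beta * s)).
  by rewrite /K; congr (_ - _); field.
have [brE|ne] := eqVneq (beta * r) bs.
  by rewrite !KE brE -bsE; split.
suff : K beta (m bs) < K beta r by move=> h; split; [exact: ltW|rewrite leNgt h].
rewrite !KE -bsE; apply: reduced_energy_min_gen => //.
- by case: H => [[_ ->]//|[/ltW]].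
- move=> b b0 bbs; case: H => [[_ bs0]|[bs0 _]]; first by move: bbs; rewrite bs0 ltNge ltW.
  rewrite -(critical_ratio bs0 bsE) mulrC -ltr_pdivlMr//.
  exact: tilt_mean_ratio_decr.
- move=> b; case: H => [[beN ->] b0|[bs0 _] bbs].
    apply: lt_le_trans (tilt_mean_ltN i mu_unif b0) _.
    by rewrite ler_wpM2l ?(ltW b0)// lef_pV2 ?posrE.
  have b0 := lt_trans bs0 bbs.
  rewrite -(critical_ratio bs0 bsE) mulrC -ltr_pdivrMr//.
  exact: tilt_mean_ratio_decr.
- by rewrite mulr_ge0.
Qed.

Lemma critical_small (e : R) : 0 < e -> exists2 d, 0 < d &
  forall beta b, N%:R < beta -> beta < N%:R + d -> 0 < b -> b = beta * m b -> b < e.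
Proof.
move=> e0; have me := tilt_mean_gt0 i mu_unif e0.
(* With this choice [N + d = e / m e] is the value of [beta] whose critical point is [e]; as
   [b / m b] increases with [b], a smaller [beta] has a smaller critical point. *)
exists (e / m e - N%:R).
  rewrite subr_gt0 ltr_pdivlMr// mulrC -ltr_pdivlMr//.
  exact: tilt_mean_ltN.
move=> beta b Nb; rewrite addrC subrK => be b0 bE.
rewrite ltNge; apply/negP => eb.
have : m b / b <= m e / e.
  move: eb; rewrite le_eqVlt => /predU1P[->//|eb].
  by rewrite ltW// tilt_mean_ratio_decr.
rewrite (critical_ratio b0 bE) -[m e / e]invrK lef_pV2 ?posrE ?(lt_trans N_gt0 Nb)//; last first.
  by rewrite invr_gt0 divr_gt0.
by rewrite invf_div leNgt be.
Qed.
End Minimization.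

(** * Densities and relative entropy *)

Section Density.
Context {R : realType} {N : nat}.
Implicit Types (mu nu : probability (vec R N) R) (f : vec R N -> R).
Local Notation S := (@sphere R N).

Lemma density_ae_eq mu nu f g : density_of mu nu f -> density_of mu nu g ->
  ae_eq mu setT (EFin \o f) (EFin \o g).
Proof.
move=> [mf [f0 fE]] [mg [g0 gE]]; apply: integral_ae_eq => //.
- apply/integrableP; split; first exact/measurable_EFinP.
  rewrite (@eq_integral _ _ _ _ _ (EFin \o f)).
    by rewrite -fE// probability_setT ltry.
  by move=> x _ /=; rewrite ger0_norm.
- exact/measurable_EFinP.
- by move=> E _ mE; rewrite -fE// -gE.
Qed.

(** [relent] picks its density by choice; two densities agree almost everywhere, so any of them
    computes it. *)
Lemma relent_density mu nu f : density_of mu nu f ->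
  relent mu nu = (\int[mu]_x (f x * ln (f x))%:E)%E.
Proof.
move=> df; rewrite /relent; case: pselect => [h|[]]; last by exists f.
case: cid => g dg /=.
have mln h' : density_of mu nu h' -> measurable_fun setT (fun x => (h' x * ln (h' x))%:E).
  move=> [mh _]; apply/measurable_EFinP; apply: measurable_funM => //.
  by apply: measurableT_comp => //; exact: measurable_ln.
apply: ae_eq_integral => //; [exact: mln|exact: mln|].
apply: filterS (density_ae_eq dg df) => x /= + _ => /(_ I)[->].
by [].
Qed.

Lemma relent_cases mu nu : relent mu nu = +oo%E \/
  exists2 f, density_of mu nu f & relent mu nu = (\int[mu]_x (f x * ln (f x))%:E)%E.
Proof.
rewrite {1}/relent; case: pselect => [[f df]|_]; last by left.
by right; exists f => //; exact: relent_density.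
Qed.

(** Pass through the Radon-Nikodym derivative, with which [f] agrees almost everywhere. *)
Lemma integral_density mu nu f U (h : vec R N -> \bar R) : density_of mu nu f ->
  measurable U -> nu.-integrable U h ->
  (\int[nu]_(x in U) h x = \int[mu]_(x in U) (h x * (f x)%:E))%E.
Proof.
move=> [mf [f0 fE]] mU ih.
have dom : nu `<< mu.
  apply/null_content_dominatesP => A mA muA; rewrite fE//.
  rewrite null_set_integral//; apply/measurable_EFinP; exact: measurable_funTS.
rewrite -(Radon_Nikodym_change_of_variables dom)//=.
apply: ae_eq_integral => //.
- apply: emeasurable_funM; first exact: measurable_int ih.
  apply: (measurable_int mu); apply: (integrableS _ _ (@subsetT _ _)) => //=.
  exact: Radon_Nikodym_integrable.
- apply: emeasurable_funM; first exact: measurable_int ih.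
  by apply/measurable_EFinP; exact: measurable_funTS.
- apply: ae_eqe_mul2l => /=.
  rewrite Radon_NikodymE//=; case: cid => /= k [h1 h2 h3].
  apply: integral_ae_eq => //=.
  + exact: integrableS h2.
  + by apply/measurable_EFinP; exact: measurable_funTS.
  + by move=> E EU mE; rewrite -h3// fE.
Qed.

Section DensityMeasure.
Variables (mu : probability (vec R N) R) (f : vec R N -> R).
Hypotheses (mf : measurable_fun setT f) (f_ge0 : forall x, 0 <= f x)
  (f1 : (\int[mu]_x (f x)%:E = 1)%E).

Definition density_prob (A : set (vec R N)) : \bar R := (\int[mu]_(x in A) (f x)%:E)%E.

Let density0 : density_prob set0 = 0%E.
Proof. by rewrite /density_prob integral_set0. Qed.

Let density_ge0 A : (0 <= density_prob A)%E.
Proof. by apply: integral_ge0 => x _; rewrite lee_fin. Qed.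

Let density_sigma_additive : semi_sigma_additive density_prob.
Proof.
apply: semi_sigma_additive_nng_induced; first exact/measurable_EFinP.
by move=> x; rewrite lee_fin.
Qed.

HB.instance Definition _ := isMeasure.Build _ _ _ density_prob
  density0 density_ge0 density_sigma_additive.

HB.instance Definition _ := @Measure_isProbability.Build _ _ R density_prob f1.

Lemma density_prob_ex : exists nu : probability (vec R N) R, density_of mu nu f.
Proof. by exists (density_prob : probability (vec R N) R). Qed.

End DensityMeasure.

(** The integrable minorant keeps the negative part of [F] finite, so the positive part must
    diverge. In [gibbs] this settles the densities of infinite entropy. *)
Lemma integral_eq_pinfty mu (F L : vec R N -> \bar R) U : measurable U ->
  measurable_fun U F -> mu.-integrable U L -> (forall x, U x -> (L x <= F x)%E) ->
  ~ mu.-integrable U F -> (\int[mu]_(x in U) F x = +oo)%E.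
Proof.
move=> mU mF iL LF nF.
have negF : (\int[mu]_(x in U) F^\- x < +oo)%E.
  apply: le_lt_trans (integral_funeneg_lt_pinfty mU iL).
  apply: ge0_le_integral => //.
  - exact: measurable_funeneg.
  - by apply: measurable_funeneg; exact: measurable_int iL.
  - move=> x Ux; apply: (@funeneg_le _ _ U); last by rewrite inE.
    by move=> y; rewrite inE => Uy; exact: LF.
have negF0 : (0 <= \int[mu]_(x in U) F^\- x)%E by exact: integral_ge0.
have posF : (\int[mu]_(x in U) F^\+ x = +oo)%E.
  apply: contra_notP nF => /eqP; rewrite -ltey => posF.
  apply/integrableP; split => //.
  rewrite -[fun x => _]/(abse \o F) fune_abse ge0_integralD//.
  - by rewrite lte_add_pinfty.
  - exact: measurable_funepos.
  - exact: measurable_funeneg.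
rewrite integralE posF addye//.
by move: negF negF0; case: (\int[mu]_(x in U) F^\- x)%E.
Qed.

End Density.

(** * Gibbs' inequality *)

Section Gibbs.
Context {R : realType} {N : nat} (mu : probability (vec R N) R) (i : 'I_N).
Hypothesis mu_unif : is_uniform_sphere mu.
Implicit Types (nu : probability (vec R N) R) (x y : vec R N).
Local Notation S := (@sphere R N).
Local Notation M e b := (mgfn mu i e b).
Local Notation m := (tilt_mean mu i).

(** This is [exp t >= 1 + t] at [t = ln g - ln u]. The term [u - g] makes the bound hold pointwise
    and integrates to 0 between two probability densities. *)
Lemma klein (u g : R) : 0 <= u -> 0 < g -> u * ln g + u - g <= u * ln u.
Proof.
rewrite le_eqVlt => /predU1P[<-|u0] g0; first by rewrite !mul0r !add0r oppr_le0 ltW.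
have := expR_ge1Dx (ln g - ln u); rewrite expRB !lnK ?posrE// => h.
have {h} : u * (1 + (ln g - ln u)) <= g by rewrite mulrC -ler_pdivlMr.
by lra.
Qed.

Lemma klein_eq (u g : R) : 0 <= u -> 0 < g -> u * ln u = u * ln g + u - g -> u = g.
Proof.
rewrite le_eqVlt => /predU1P[<-|u0] g0.
  by rewrite !mul0r !add0r => /esym/eqP; rewrite oppr_eq0 => /eqP ->.
have [ug|ug] := eqVneq (ln g - ln u) 0.
  by move=> _; apply: ln_inj; rewrite ?posrE//; lra.
have := expR_gt1Dx ug; rewrite expRB !lnK ?posrE// => h.
have {h} : u * (1 + (ln g - ln u)) < g by rewrite mulrC -ltr_pdivlMr.
by lra.
Qed.

Definition tilt x (b : R) y : R := expR (b * dotp x y) / M 0 b.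

Lemma measurable_tilt x b : measurable_fun setT (tilt x b).
Proof.
apply: measurable_funM => //; apply: measurableT_comp => //.
by apply: measurable_funM => //; exact: measurable_dotp.
Qed.

Lemma tilt_gt0 x b y : 0 < tilt x b y.
Proof. by rewrite divr_gt0 ?expR_gt0 ?mgf_gt0. Qed.

Lemma ln_tilt x b y : ln (tilt x b y) = b * dotp x y - ln (M 0 b).
Proof. by rewrite ln_div ?posrE ?expR_gt0 ?mgf_gt0// expRK. Qed.

Lemma mgfn_dotp x e b : S x ->
  \int[mu]_(y in S) (dotp x y ^+ e * expR (b * dotp x y)) = M e b.
Proof.
move=> Sx; rewrite (@Rintegral_dotp _ _ mu x i (fun t => t ^+ e * expR (b * t)) (expR `|b|))//.
- apply: measurable_funM; first exact: exprn_measurable.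
  by apply: measurableT_comp => //; exact: mulrl_measurable.
- move=> t t1; rewrite normrM -[leRHS]mul1r ler_pM//.
    by rewrite normrX exprn_ile1.
  rewrite ger0_norm ?expR_ge0// ler_expR (le_trans (ler_norm _))// normrM.
  by rewrite ler_piMr.
Qed.

Lemma dotp_expR_le x b y : S x -> S y -> expR (b * dotp x y) <= expR `|b|.
Proof.
move=> Sx Sy; rewrite ler_expR (le_trans (ler_norm _))// normrM ler_piMr//.
exact: le_dotp_sphere.
Qed.

Lemma measurable_expR_dotp x b : measurable_fun setT (fun y => expR (b * dotp x y)).
Proof.
by apply: measurableT_comp => //; apply: measurable_funM => //; exact: measurable_dotp.
Qed.

Lemma integrable_expR_dotp nu x b : S x ->
  nu.-integrable S (EFin \o (fun y => expR (b * dotp x y))).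
Proof.
move=> Sx; apply: (@integrable_sphere R N _ _ (expR `|b|)); first exact: measurable_expR_dotp.
by move=> y Sy; rewrite ger0_norm ?expR_ge0// dotp_expR_le.
Qed.

Lemma integrable_tilt nu x b : S x -> nu.-integrable S (EFin \o tilt x b).
Proof.
move=> Sx; apply: (@integrable_sphere R N _ _ (expR `|b| / M 0 b)).
  exact: measurable_tilt.
move=> y Sy; rewrite ger0_norm ?(ltW (tilt_gt0 _ _ _))//.
by rewrite ler_wpM2r ?invr_ge0 ?(ltW (mgf_gt0 _ _ _))// dotp_expR_le.
Qed.

Lemma Rintegral_tilt x b : S x -> \int[mu]_(y in S) tilt x b y = 1.
Proof.
move=> Sx; rewrite RintegralZr//; last exact: integrable_expR_dotp.
rewrite (@eq_Rintegral _ _ _ mu S (fun y => dotp x y ^+ 0 * expR (b * dotp x y))).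
  by rewrite mgfn_dotp// divff// gt_eqF// mgf_gt0.
by move=> y _; rewrite expr0 mul1r.
Qed.

Lemma integral_tilt x b : S x -> (\int[mu]_y (tilt x b y)%:E = 1)%E.
Proof.
move=> Sx; rewrite integral_sphere ?mu_unif.1//; last first.
  by apply/measurable_EFinP; exact: measurable_tilt.
rewrite -[1%E]/(1%:E) -(Rintegral_tilt b Sx) /Rintegral fineK//.
by apply: integrable_fin_num => //; exact: integrable_tilt.
Qed.

Lemma fine_integral_expR x b : S x ->
  fine (\int[mu]_z (expR (b * dotp x z))%:E)%E = M 0 b.
Proof.
move=> Sx; rewrite integral_sphere ?mu_unif.1//; last first.
  by apply/measurable_EFinP; exact: measurable_expR_dotp.
rewrite -(mgfn_dotp 0 b Sx); congr fine.
by apply: eq_integral => y _; rewrite expr0 mul1r.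
Qed.

Lemma tilt_prob_ex x b : S x -> exists nu, density_of mu nu (tilt x b).
Proof.
move=> Sx; apply: density_prob_ex; first exact: measurable_tilt.
- by move=> y; exact/ltW/tilt_gt0.
- exact: integral_tilt.
Qed.

Lemma tilt_on_sphere nu x b : S x -> density_of mu nu (tilt x b) -> on_sphere nu.
Proof.
move=> Sx [mf [f0 fE]]; rewrite /on_sphere fE// -integral_sphere ?mu_unif.1 ?integral_tilt//.
exact/measurable_EFinP.
Qed.

Definition dotmean x nu : R := \sum_(j < N) tnth x j * mean nu j.

Lemma dotmeanE nu x : \int[nu]_(y in S) dotp x y = dotmean x nu.
Proof.
have ij j : nu.-integrable S (EFin \o (fun y => tnth y j)).
  apply: (@integrable_sphere R N _ _ 1); first exact: measurable_tnth.
  by move=> y; exact: sphere_coord_le1.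
rewrite Rintegral_sphere_sum; last by move=> j; exact: integrable_RZl.
by apply: eq_bigr => j _; rewrite RintegralZl.
Qed.

Lemma Rintegral_ln_tilt nu x b : on_sphere nu -> S x ->
  \int[nu]_(y in S) ln (tilt x b y) = b * dotmean x nu - ln (M 0 b).
Proof.
move=> nuS Sx.
rewrite (@eq_Rintegral _ _ _ nu S (fun y => b * dotp x y - cst (ln (M 0 b)) y)); last first.
  by move=> y _; rewrite ln_tilt.
have id : nu.-integrable S (EFin \o dotp x).
  apply: (@integrable_sphere R N _ _ 1); first exact: measurable_dotp.
  by move=> y; exact: le_dotp_sphere.
rewrite RintegralB//; [|exact: integrable_RZl|exact: finite_measure_integrable_cst].
rewrite RintegralZl// dotmeanE Rintegral_cst// (_ : fine _ = 1) ?mulr1//.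
exact: (congr1 fine nuS).
Qed.

Lemma integrable_ln_tilt nu x b : S x -> nu.-integrable S (EFin \o (fun y => ln (tilt x b y))).
Proof.
move=> Sx; apply: (@integrable_sphere R N _ _ (`|b| + `|ln (M 0 b)|)).
  apply: measurableT_comp; first exact: measurable_ln.
  exact: measurable_tilt.
move=> y Sy; rewrite ln_tilt (le_trans (ler_normB _ _))// lerD2r normrM ler_piMr//.
exact: le_dotp_sphere.
Qed.

Lemma dotmean_tilt nu x b : S x -> density_of mu nu (tilt x b) -> dotmean x nu = m b.
Proof.
move=> Sx df; rewrite -dotmeanE.
have id : nu.-integrable S (EFin \o dotp x).
  apply: (@integrable_sphere R N _ _ 1); first exact: measurable_dotp.
  by move=> y; exact: le_dotp_sphere.
rewrite /Rintegral (integral_density df)//.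
rewrite (@eq_integral _ _ _ _ _ (fun y => (dotp x y ^+ 1 * expR (b * dotp x y) * (M 0 b)^-1)%:E)).
  rewrite -[LHS]/(\int[mu]_(y in S) (dotp x y ^+ 1 * expR (b * dotp x y) * (M 0 b)^-1)).
  rewrite (RintegralZr _ measurable_sphere) ?mgfn_dotp//.
  apply: (@integrable_sphere R N _ _ (expR `|b|)).
    apply: measurable_funM; last exact: measurable_expR_dotp.
    by apply: measurable_funX; exact: measurable_dotp.
  move=> y Sy; rewrite normrM -[leRHS]mul1r ler_pM//.
    by rewrite expr1 le_dotp_sphere.
  by rewrite ger0_norm ?expR_ge0// dotp_expR_le.
by move=> y _; rewrite -EFinM expr1 mulrA.
Qed.

Lemma relent_sphere nu f : density_of mu nu f ->
  relent mu nu = (\int[mu]_(y in S) (f y * ln (f y))%:E)%E.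
Proof.
move=> df; rewrite (relent_density df) integral_sphere ?mu_unif.1//.
apply/measurable_EFinP; apply: measurable_funM; first exact: df.1.
by apply: measurableT_comp; [exact: measurable_ln|exact: df.1].
Qed.

Lemma relent_tilt nu x b : S x -> density_of mu nu (tilt x b) ->
  relent mu nu = (b * dotmean x nu - ln (M 0 b))%:E.
Proof.
move=> Sx df; rewrite (relent_sphere df) -(Rintegral_ln_tilt b (tilt_on_sphere Sx df) Sx).
rewrite /Rintegral fineK; last first.
  by apply: integrable_fin_num => //; exact: integrable_ln_tilt.
rewrite (integral_density df)//; last exact: integrable_ln_tilt.
by apply: eq_integral => y _; rewrite -EFinM mulrC.
Qed.

Lemma gibbs nu x b : on_sphere nu -> S x ->
  ((b * dotmean x nu - ln (M 0 b))%:E <= relent mu nu)%E /\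
  ((relent mu nu <= (b * dotmean x nu - ln (M 0 b))%:E)%E -> density_of mu nu (tilt x b)).
Proof.
move=> nuS Sx; have [->|[f df _]] := relent_cases mu nu.
  by rewrite leey; split => //; rewrite leye_eq.
rewrite (relent_sphere df); have [mf [f0 fE]] := df.
set c := b * dotmean x nu - ln (M 0 b).
pose F y := f y * ln (f y); pose g := tilt x b.
(* The lower bound of [klein]; as [f] and [g] both have mass 1, its integral is [c]. *)
pose L y := f y * ln (g y) + f y - g y.
have mg : measurable_fun setT g by exact: measurable_tilt.
have mF : measurable_fun setT F.
  by apply: measurable_funM => //; apply: measurableT_comp => //; exact: measurable_ln.
have if_ : mu.-integrable S (EFin \o f).
  apply/integrableP; split; first exact/measurable_EFinP/measurable_funTS.
  rewrite (@eq_integral _ _ _ _ S (EFin \o f)); last first.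
    by move=> y _ /=; rewrite ger0_norm.
  by rewrite -fE// nuS ltry.
have If : \int[mu]_(y in S) f y = 1 by rewrite /Rintegral -fE// nuS.
have ig : mu.-integrable S (EFin \o g) by exact: integrable_tilt.
have Iln : (\int[mu]_(y in S) (f y * ln (g y))%:E = c%:E)%E.
  rewrite /c -(Rintegral_ln_tilt b nuS Sx) /Rintegral fineK; last first.
    by apply: integrable_fin_num => //; exact: integrable_ln_tilt.
  rewrite (integral_density df)//; last exact: integrable_ln_tilt.
  by apply: eq_integral => y _; rewrite -EFinM mulrC.
have ifln : mu.-integrable S (EFin \o (fun y => f y * ln (g y))).
  have := integrableMl measurable_sphere if_ (h := fun y => ln (g y)).
  apply.
    by apply: measurable_funTS; apply: measurableT_comp; [exact: measurable_ln|].
  exists (`|b| + `|ln (M 0 b)|); split; first exact: num_real.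
  move=> K MK y /= Sy; rewrite (le_trans _ (ltW MK))//.
  rewrite ln_tilt (le_trans (ler_normB _ _))// lerD2r normrM ler_piMr//.
  exact: le_dotp_sphere.
have iL : mu.-integrable S (EFin \o L).
  exact: (integrable_RB (integrableD measurable_sphere ifln if_) ig).
have IL : \int[mu]_(y in S) L y = c.
  rewrite RintegralB//; last exact: (integrableD measurable_sphere ifln if_).
  by rewrite RintegralD// If Rintegral_tilt// addrK /Rintegral Iln.
have LF y : L y <= F y by apply: klein => //; exact: tilt_gt0.
(* [L] is integrable because [ln g] is bounded on the sphere, but [F] may fail to be; the entropy is
   then infinite, and the equality case is void. *)
have [iF|nF] := pselect (mu.-integrable S (EFin \o F)); last first.
  rewrite (_ : integral _ _ _ = +oo%E); last first.
    apply: (integral_eq_pinfty measurable_sphere _ iL) => //.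
      by apply/measurable_EFinP/measurable_funTS.
    by move=> y _; rewrite lee_fin.
  by rewrite leey; split => //; rewrite leye_eq.
have iD := integrable_RB iF iL.
have ID : \int[mu]_(y in S) (F y - L y) = \int[mu]_(y in S) F y - c.
  by rewrite RintegralB// IL.
have -> : (\int[mu]_(y in S) (f y * ln (f y))%:E = (\int[mu]_(y in S) F y)%:E)%E.
  by rewrite /Rintegral fineK//; exact: integrable_fin_num.
rewrite !lee_fin -subr_ge0 -ID; split.
  by apply: Rintegral_ge0 => y _; rewrite subr_ge0.
(* Equality case: [F - L] is nonnegative with integral 0, so [f = g] almost everywhere on the sphere
   by [klein_eq]. *)
rewrite -subr_le0 -ID => ID0.
have {}ID0 : (\int[mu]_(y in S) `|(F y - L y)%:E| = 0)%E.
  rewrite (@eq_integral _ _ _ _ S (fun y => (F y - L y)%:E)); last first.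
    by move=> y _; rewrite gee0_abs// lee_fin subr_ge0.
  apply/eqP; rewrite eq_le; apply/andP; split; last first.
    by apply: integral_ge0 => y _; rewrite lee_fin subr_ge0.
  rewrite -(fineK (integrable_fin_num measurable_sphere iD)) lee_fin.
  exact: ID0.
move: ID0 => /ae_eq_integral_abs => /(_ measurable_sphere (measurable_int _ iD)) ae0.
have fg : ae_eq mu S (EFin \o f) (EFin \o g).
  apply: filterS ae0 => y /= h Sy; congr EFin.
  apply: klein_eq; rewrite ?tilt_gt0//.
  by have [] := h Sy => /eqP; rewrite subr_eq0 => /eqP.
(* The complement of the sphere is null, so the equality passes to integrals over any measurable
   set. *)
have muSC : {ae mu, forall y, S y}.
  exists (~` S); split; first exact: measurableC.
    by rewrite probability_setC ?mu_unif.1 ?subee.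
  by move=> y /=.
split => //; split; first by move=> y; exact/ltW/tilt_gt0.
move=> A mA; rewrite fE//; apply: ae_eq_integral => //.
- by apply/measurable_EFinP/measurable_funTS.
- by apply/measurable_EFinP/measurable_funTS.
- by apply: filterS2 muSC fg => y Sy + _ => /(_ Sy).
Qed.
End Gibbs.

(** * Macrostates *)

Section Macrostates.
Context {R : realType} {N : nat} (mu : probability (vec R N) R) (i : 'I_N).
Hypothesis mu_unif : is_uniform_sphere mu.
Implicit Types (nu : probability (vec R N) R) (x y : vec R N).
Local Notation S := (@sphere R N).
Local Notation M e b := (mgfn mu i e b).
Local Notation m := (tilt_mean mu i).
Local Notation K := (reduced_energy mu i).
Local Notation tilt := (tilt mu i).

Definition sqmean nu : R := \sum_(j < N) mean nu j ^+ 2.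

Lemma sqmean_ge0 nu : 0 <= sqmean nu.
Proof. by apply: sumr_ge0 => j _; exact: sqr_ge0. Qed.

Lemma sqr_dotmean_le x nu : S x -> dotmean x nu ^+ 2 <= sqmean nu.
Proof.
rewrite /sphere /= => x1; set t := dotmean x nu; rewrite -subr_ge0.
have -> : sqmean nu - t ^+ 2 = \sum_(j < N) (mean nu j - t * tnth x j) ^+ 2.
  rewrite [RHS](eq_bigr (fun j => mean nu j ^+ 2 + t ^+ 2 * (tnth x j * tnth x j)
    - 2 * t * (tnth x j * mean nu j))); last by move=> j _; ring.
  rewrite sumrB big_split/= -!mulr_sumr -/(dotp x x) x1 -/(dotmean x nu) -/t -/(sqmean nu).
  ring.
by apply: sumr_ge0 => j _; exact: sqr_ge0.
Qed.

Lemma sphere_ex : exists x, S x.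
Proof.
exists [tuple (j == i)%:R | j < N]; rewrite /sphere /= /dotp (bigD1 i)//= big1.
  by rewrite tnth_mktuple eqxx mulr1 addr0.
by move=> j /negbTE ji; rewrite tnth_mktuple ji mul0r.
Qed.

Lemma mean_direction nu : exists2 x, S x & dotmean x nu = Num.sqrt (sqmean nu).
Proof.
pose r := Num.sqrt (sqmean nu).
have r2 : r ^+ 2 = sqmean nu by rewrite sqr_sqrtr// sqmean_ge0.
(* If the mean is zero, every direction serves, as the component along it vanishes. *)
have [r0|r0] := eqVneq r 0.
  have [x Sx] := sphere_ex; exists x => //.
  have h : dotmean x nu ^+ 2 <= r ^+ 2 by rewrite r2; exact: sqr_dotmean_le.
  rewrite r0 expr0n/= in h.
  by rewrite [RHS]r0; apply/eqP; rewrite -sqrf_eq0 eq_le h sqr_ge0.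
exists [tuple mean nu j / r | j < N]; rewrite /sphere /= /dotp /dotmean.
  rewrite (eq_bigr (fun j => mean nu j ^+ 2 / r ^+ 2)); last first.
    by move=> j _; rewrite tnth_mktuple; field.
  by rewrite -mulr_suml -/(sqmean nu) -r2 divff// expf_neq0.
rewrite (eq_bigr (fun j => mean nu j ^+ 2 / r)); last first.
  by move=> j _; rewrite tnth_mktuple; field.
by rewrite -mulr_suml -/(sqmean nu) -[RHS]/r -r2; field.
Qed.

Lemma freeE_ge beta nu : on_sphere nu ->
  let r := Num.sqrt (sqmean nu) in
  ((K beta r)%:E <= Defs.freeE mu beta nu)%E /\
  ((Defs.freeE mu beta nu <= (K beta r)%:E)%E ->
   exists2 x, S x & density_of mu nu (tilt x (beta * r))).
Proof.
move=> nuS r; have [x Sx xr] := mean_direction nu.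
have r2 : r ^+ 2 = sqmean nu by rewrite sqr_sqrtr// sqmean_ge0.
have [h1 h2] := gibbs i mu_unif (beta * r) nuS Sx.
have KE : beta * r * dotmean x nu - ln (M 0 (beta * r)) = K beta r + beta / 2 * sqmean nu.
  by rewrite xr -/r -r2 /reduced_energy; field.
rewrite KE in h1 h2; rewrite /Defs.freeE -/(sqmean nu); split.
  by rewrite leeBrDr.
by rewrite leeBlDr// => h; exists x => //; exact: h2.
Qed.

(** Only the component [m b] of the mean along [x] is known here. By Cauchy-Schwarz the mean is at
    least that long, which is the direction an upper bound on the free energy needs. *)
Lemma freeE_tilt_le beta b x nu : 0 <= beta -> b = beta * m b -> S x ->
  density_of mu nu (tilt x b) -> (Defs.freeE mu beta nu <= (K beta (m b))%:E)%E.
Proof.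
move=> be0 bE Sx df; rewrite /Defs.freeE (relent_tilt mu_unif Sx df) -/(sqmean nu).
have dm := dotmean_tilt mu_unif Sx df.
have := sqr_dotmean_le nu Sx; rewrite dm => h.
rewrite -EFinB lee_fin /reduced_energy -bE.
have -> : b * m b = beta * m b ^+ 2 by rewrite {1}bE expr2 -mulrA.
have : beta / 2 * m b ^+ 2 <= beta / 2 * sqmean nu by rewrite ler_wpM2l// divr_ge0.
lra.
Qed.

(** Comparing a minimizer with one tilted law gives [K r <= freeE nu <= K (m b) <= K r]. Equality on
    the left makes [nu] a tilted law with parameter [beta * r], and equality on the right makes this
    parameter [b]. *)
Lemma macrostateP beta b nu : 0 <= beta ->
  (beta <= N%:R /\ b = 0) \/ (0 < b /\ b = beta * m b) -> on_sphere nu ->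
  macrostate mu beta nu <-> exists2 x, S x & density_of mu nu (tilt x b).
Proof.
move=> be0 crit nuS.
have bE : b = beta * m b.
  by case: crit => [[_ ->]|[]//]; rewrite tilt_mean0// mulr0.
have Kmin r : 0 <= r -> K beta (m b) <= K beta r /\
    (K beta r <= K beta (m b) -> beta * r = b).
  by move=> r0; exact: reduced_energy_min.
split=> [[_ nu_min]|[x Sx df]].
  have [x0 Sx0] := sphere_ex.
  have [nu0 d0] := tilt_prob_ex i mu_unif b Sx0.
  have le0 := le_trans (nu_min _ (tilt_on_sphere mu_unif Sx0 d0))
    (freeE_tilt_le be0 bE Sx0 d0).
  have [h1 h2] := freeE_ge beta nuS.
  set r := Num.sqrt _ in h1 h2.
  have [k1 k2] := Kmin r (sqrtr_ge0 _).
  have kr : K beta r <= K beta (m b) by rewrite -lee_fin; exact: le_trans h1 le0.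
  have k1E : ((K beta (m b))%:E <= (K beta r)%:E)%E by rewrite lee_fin; exact: k1.
  have [x Sx df] := h2 (le_trans le0 k1E).
  by rewrite (k2 kr) in df; exists x.
split => // nu' nu'S.
have [h1 _] := freeE_ge beta nu'S.
apply: le_trans (freeE_tilt_le be0 bE Sx df) (le_trans _ h1).
by rewrite lee_fin; exact: (Kmin _ (sqrtr_ge0 _)).1.
Qed.
End Macrostates.

(** * The two regimes of [beta] and the limit of the critical point *)

Theorem theorem2p7 (R : realType) (N : nat)
  (mu : probability (vec R N) R) (beta : R) :
  (2 <= N)%N -> is_uniform_sphere mu -> 0 <= beta ->
  (* Phi_beta extends continuously to b = 0 *)
  cvg (Phi N beta x @[x --> 0^'+]) /\
  (* (a) *)
  (beta <= N%:R ->
     (forall b, 0 <= b -> PhiExt N beta 0 <= PhiExt N beta b) /\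
     (forall nu : probability (vec R N) R, on_sphere nu ->
        (macrostate mu beta nu <->
         forall A : set (vec R N), measurable A -> nu A = mu A))) /\
  (* (b) *)
  (N%:R < beta ->
     exists b, 0 < b /\ b = beta * ratioI N b /\
       (forall b', 0 < b' -> b' = beta * ratioI N b' -> b' = b) /\
       (forall b', 0 <= b' -> PhiExt N beta b <= PhiExt N beta b') /\
       (forall b', 0 <= b' -> PhiExt N beta b' <= PhiExt N beta b -> b' = b) /\
       (forall nu : probability (vec R N) R, on_sphere nu ->
          (macrostate mu beta nu <->
           exists x, sphere x /\
             forall A : set (vec R N), measurable A ->
               nu A = (\int[mu]_(y in A)
                 (expR (b * dotp x y)
                  / fine (\int[mu]_z (expR (b * dotp x z))%:E))%:E)%E))) /\
  (* lim_{beta' decreasing to N} b(beta') = 0 *)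
  (forall e : R, 0 < e -> exists d : R, 0 < d /\
     forall beta' b : R, N%:R < beta' -> beta' < N%:R + d ->
       0 < b -> b = beta' * ratioI N b -> b < e).
Proof.
move=> N2 mu_unif be0.
(* The coordinate 0 stands for any other: all have the same law under [mu]. *)
pose i : 'I_N := Ordinal (ltnW N2).
have rE b : 0 < b -> ratioI N b = tilt_mean mu i b by exact: ratioI_tilt_mean.
have PE b : 0 <= b -> PhiExt N beta b = tilt_free_energy mu i beta b + ln (@Phi_const R N).
  exact: PhiExt_tilt_free_energy.
(* Serves both regimes: [b = 0] when [beta <= N], the positive critical point when [beta > N]. *)
have crit b : (beta <= N%:R /\ b = 0) \/ (0 < b /\ b = beta * tilt_mean mu i b) ->
    [/\ 0 <= b, b = beta * tilt_mean mu i b,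
     forall b', 0 <= b' -> PhiExt N beta b <= PhiExt N beta b' &
     forall b', 0 <= b' -> PhiExt N beta b' <= PhiExt N beta b -> b' = b].
  move=> H.
  have b0 : 0 <= b by case: H => [[_ ->]//|[/ltW]].
  have bE : b = beta * tilt_mean mu i b.
    by case: H => [[_ ->]|[]//]; rewrite tilt_mean0// mulr0.
  have Kmin b' : 0 <= b' -> _ := fun b'0 =>
    reduced_energy_min mu_unif be0 (tilt_mean_ge0 i mu_unif b'0) H.
  have crit_min b' : 0 <= b' -> PhiExt N beta b <= PhiExt N beta b'.
    move=> b'0; rewrite (PE _ b0) (PE _ b'0) lerD2r -(reduced_energyE bE).
    exact: le_trans (Kmin _ b'0).1 (reduced_energy_le_phi i mu_unif _ _).
  split; [exact: b0|exact: bE|exact: crit_min|move=> b' b'0].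
  rewrite (PE _ b0) (PE _ b'0) lerD2r -(reduced_energyE bE) => h.
  have kE := (Kmin _ b'0).2 (le_trans (reduced_energy_le_phi i mu_unif _ _) h).
  (* If [beta * m b'] differed from [b'], then [K (m b')] would lie strictly below [phi b'], hence
     below the minimum of [K]. *)
  apply/eqP; rewrite -kE eq_sym; apply/negPn/negP => /(reduced_energy_lt_phi mu_unif) h'.
  by have := lt_le_trans h' h; rewrite ltNge (Kmin _ b'0).1.
split; first by apply/cvg_ex; eexists; exact: (cvg_Phi_at0 (i := i) mu_unif N2 (beta := beta)).
split; [|split].
- move=> beN; have [_ _ min0 _] := crit 0 (or_introl (conj beN erefl)).
  split => // nu nuS.
  rewrite (macrostateP (i := i) mu_unif be0 (or_introl (conj beN erefl)) nuS).
  (* At [b = 0] the tilt is trivial, so the tilted laws all coincide with [mu]. *)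
  have t1 x : tilt mu i x 0 = cst 1.
    by apply/funext => y; rewrite /tilt mul0r expR0 mgf00// divr1.
  have c1 (A : set (vec R N)) : measurable A ->
      (\int[mu]_(y in A) (cst (1 : R) y)%:E = mu A)%E.
    by move=> mA; rewrite -[RHS]mul1e -integral_cst.
  split=> [[x _]|nuE].
    by rewrite t1 => -[_ [_ nuE]] A mA; rewrite nuE// c1.
  have [x Sx] := @sphere_ex R N i; exists x => //; rewrite t1.
  split; first exact: measurable_cst.
  by split => // A mA; rewrite nuE// c1.
- move=> Nbe; have [b [b0 bE]] := critical_ex i mu_unif Nbe.
  have [_ _ minb uniqb] := crit b (or_intror (conj b0 bE)).
  exists b; split => //; split; first by rewrite rE.
  split; first by move=> b' b'0; rewrite rE// => /(critical_uniq mu_unif b0 bE b'0).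
  split => //; split => // nu nuS.
  rewrite (macrostateP mu_unif be0 (or_intror (conj b0 bE)) nuS).
  split=> [[x Sx [_ [_ nuE]]]|[x [Sx nuE]]]; exists x; try exact: Sx.
    split; first exact: Sx.
    by move=> A mA; rewrite (fine_integral_expR i mu_unif b Sx); exact: nuE.
  split; first exact: measurable_tilt.
  split; first by move=> y; exact/ltW/tilt_gt0.
  by move=> A mA; rewrite (nuE A mA) (fine_integral_expR i mu_unif b Sx).
- move=> e e0; have [d d0 hd] := critical_small i mu_unif e0.
  exists d; split => // beta' b Nb bd b0; rewrite rE// => bE.
  exact: hd bE.
Qed.
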